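(* Let $L/K$ be a finite totally ramified Galois extension of degree $e$ with $L\neq K$, let $\pi_L$ be a uniformizer of $L$ and $f\in E_K^e$ its minimal polynomial over $K$. The property $(\mathrm{T}^e_m)$ for $m=u_{L/K}$ is equivalent to the condition $\mathrm{Hom}_{\mathrm{cont}}(G_k,G_{(i_{L/K})})=1$.
   Context: $K$ is a complete discrete valuation field with residue field $k$ of characteristic $p>0$ ($k$ may be imperfect), $v_K$ is its valuation normalized by $v_K(K^\times)=\mathbb{Z}$, extended uniquely to a fixed algebraic closure $\Omega$ of $K$; all algebraic extensions of $K$ are taken inside $\Omega$. $\mathcal{O}_L$ is the valuation ring of $L$. $G_k$ is the absolute Galois group of $k$, and $\mathrm{Hom}_{\mathrm{cont}}(G_k,H)$ denotes continuous homomorphisms to the finite discrete group $H$; ''$=1$'' means that only the trivial homomorphism exists. $E_K^e$ is the set of (monic) Eisenstein polynomials over $K$ of degree $e$. For $g=\sum a_iX^i$, $h=\sum b_iX^i\in E_K^e$ put $v_K(g,h)=\min_{0\le i\le e-1}\{v_K(a_i-b_i)+i/e\}$. For $g\in E_K^e$ put $M_g=K(\pi_g)$ with $\pi_g\in\Omega$ a root of $g$. For a real number $m\ge 0$, property $(\mathrm{T}^e_m)$ (for $f$): for any $g\in E_K^e$, if $v_K(f,g)\ge m$ then there is a $K$-isomorphism $L\cong M_g$. Ramification breaks: let $G=\mathrm{Gal}(L/K)$. For $\sigma\in G$ put $\mathbf{i}_{L/K}(\sigma)=\inf_{a\in\mathcal{O}_L}v_K(\sigma(a)-a)$ and $G_{(i)}=\{\sigma\in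 G: \mathbf{i}_{L/K}(\sigma)\ge i\}$ for real $i\ge 0$. Let $\widetilde\varphi_{L/K}(i)=\int_0^i \#G_{(t)}\,dt$, $\mathbf{u}_{L/K}(\sigma)=\widetilde\varphi_{L/K}(\mathbf{i}_{L/K}(\sigma))$ and $G^{(u)}=\{\sigma\in G:\mathbf{u}_{L/K}(\sigma)\ge u\}$ for real $u\ge 0$. Then $i_{L/K}=\inf\{i:G_{(i)}=1\}$ and $u_{L/K}=\inf\{u: G^{(u)}=1\}$. *)

(* Defs.v *)
From HB Require Import structures.
From mathcomp Require Import all_boot all_order all_algebra all_fingroup.
From mathcomp Require Import all_solvable all_field.
From mathcomp Require Import all_classical all_reals all_analysis.
Set Implicit Arguments.
Unset Strict Implicit.
Unset Printing Implicit Defensive.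
Import Order.TTheory GRing.Theory Num.Theory.
Local Open Scope classical_set_scope.
Local Open Scope ring_scope.

(* Additive valuations with values in R, and v 0 = +oo. *)
Record valuation (R : realType) (F : fieldType) := Valuation {
  val_fun :> F -> \bar R;
  valuation_neqNy : forall x, val_fun x != -oo%E;
  valuation_eqy : forall x, (val_fun x == +oo%E) = (x == 0);
  valuationM : forall x y, val_fun (x * y) = (val_fun x + val_fun y)%E;
  valuationD : forall x y,
    (Order.min (val_fun x) (val_fun y) <= val_fun (x + y))%E
}.

Section ValuationTheory.
Variables (R : realType) (F : fieldType) (v : valuation R F).

Lemma valuation0 : v 0 = +oo%E.
Proof. by apply/eqP; rewrite valuation_eqy. Qed.

Lemma valuation1 : v 1 = 0%E.
Proof.
have := valuationM v 1 1; rewrite mulr1.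
have := valuation_neqNy v 1; have := valuation_eqy v 1; rewrite oner_eq0.
case: (v 1) => //= r _ _ [] /eqP.
by rewrite -subr_eq0 opprD addNKr oppr_eq0 => /eqP ->.
Qed.

Lemma valuationN1 : v (-1) = 0%E.
Proof.
have := valuationM v (-1) (-1); rewrite mulrNN mulr1 valuation1.
case: (v (-1)) => //= r [] /esym/eqP.
by rewrite -mulr2n mulrn_eq0 /= => /eqP ->.
Qed.

Lemma valuationN x : v (- x) = v x.
Proof. by rewrite -mulN1r valuationM valuationN1 add0e. Qed.

Definition val_ring : {pred F} := [pred x | (0 <= v x)%E].

Fact val_ring_subring : subring_closed val_ring.
Proof.
split=> [|x y|x y]; rewrite !inE ?valuation1 ?valuationM //; last exact: adde_ge0.
move=> x0 y0; apply: le_trans (valuationD v x (- y)).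
by rewrite le_min valuationN x0 y0.
Qed.
HB.instance Definition _ :=
  GRing.isSubringClosed.Build F val_ring val_ring_subring.

Record val_ring_of := ValRing { vr_val :> F; _ : vr_val \in val_ring }.
HB.instance Definition _ := [isSub for vr_val].
HB.instance Definition _ := [Choice of val_ring_of by <:].
HB.instance Definition _ := [SubChoice_isSubComNzRing of val_ring_of by <:].

Definition uniformizer (pi : F) : Prop :=
  (0 < v pi)%E /\ (forall x, (0 < v x)%E -> (v pi <= v x)%E).

(* [v] takes on F^* exactly the values in (1/e)Z. *)
Definition value_group_frac (e : nat) : Prop :=
  [set v x | x in [set x : F | x != 0]]
  = [set ((n%:~R / e%:R)%:E : \bar R) | n in [set: int]].

Definition normalized_discrete : Prop := value_group_frac 1.

Definition val_cauchy (u : nat -> F) : Prop :=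
  forall N : R, exists n0, forall m n, (n0 <= m)%N -> (n0 <= n)%N ->
    (N%:E <= v (u m - u n)%R)%E.

Definition val_converges (u : nat -> F) (l : F) : Prop :=
  forall N : R, exists n0, forall n, (n0 <= n)%N -> (N%:E <= v (u n - l)%R)%E.

Definition val_complete : Prop :=
  forall u, val_cauchy u -> exists l, val_converges u l.

Definition residue_map (k : fieldType) (red : {rmorphism val_ring_of -> k}) :
    Prop :=
  (forall y, exists x, red x = y) /\
  (forall x, red x = 0 <-> (0 < v (vr_val x))%E).

End ValuationTheory.

Section ValuationComp.
Variables (R : realType) (F E : fieldType) (v : valuation R E).
Variable j : {rmorphism F -> E}.

Let w x := v (j x).

Fact val_comp_neqNy x : w x != -oo%E. Proof. exact: valuation_neqNy. Qed.
Fact val_comp_eqy x : (w x == +oo%E) = (x == 0).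
Proof. by rewrite /w valuation_eqy fmorph_eq0. Qed.
Fact val_compM x y : w (x * y) = (w x + w y)%E.
Proof. by rewrite /w rmorphM valuationM. Qed.
Fact val_compD x y : (Order.min (w x) (w y) <= w (x + y)%R)%E.
Proof. by rewrite /w rmorphD valuationD. Qed.

Definition val_comp : valuation R F :=
  Valuation val_comp_neqNy val_comp_eqy val_compM val_compD.

End ValuationComp.

Section Eisenstein.
Variables (R : realType) (K : fieldType) (vK : valuation R K).

Definition eisenstein (e : nat) (g : {poly K}) : Prop :=
  [/\ g \is monic, size g = e.+1,
      forall i, (i < e)%N -> (1%:E <= vK g`_i)%E & vK g`_0 = 1%:E].

Definition eisenstein_val (e : nat) (g h : {poly K}) : \bar R :=
  \big[Order.min/+oo%E]_(i < e) (vK (g`_i - h`_i)%R + (i%:R / e%:R)%:E)%E.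

End Eisenstein.

(* As [g] is irreducible, the fields K(pi_g) for the various roots [pi_g] of [g]
   are K-isomorphic, so quantifying over all roots or fixing one is the same. *)
Definition property_T (R : realType) (K : fieldType) (vK : valuation R K)
    (Omega : fieldType) (iota : {rmorphism K -> Omega})
    (L : fieldExtType K) (e : nat) (f : {poly K}) (m : R) : Prop :=
  forall g : {poly K}, eisenstein vK e g ->
    (m%:E <= eisenstein_val vK e f g)%E ->
    forall pi_g : Omega, root (map_poly iota g) pi_g ->
      exists phi : {lrmorphism L -> subFExtend iota pi_g g}, bijective phi.

Section Ramification.
Variables (R : realType) (K : fieldType) (L : splittingFieldType K).
(* [vL] is the extension to L of the normalized valuation of K; in particular
   it is not itself normalized. *)
Variable vL : valuation R L.

Notation G := ('Gal({:L} / 1))%g.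

Definition lower_index (s : gal_of {:L}) : \bar R :=
  ereal_inf [set vL (s a - a) | a in [set a : L | a \in val_ring vL]].

Definition lower_group (i : R) : {set gal_of {:L}} :=
  [set s in G | (i%:E <= lower_index s)%E]%SET.

Definition ram_phi (i : \bar R) : \bar R :=
  (\int[lebesgue_measure]_(t in [set t : R | (0 <= t)%R /\ (t%:E <= i)%E])
     ((#|lower_group t|)%:R)%:E)%E.

Definition upper_index (s : gal_of {:L}) : \bar R := ram_phi (lower_index s).

Definition upper_group (u : R) : {set gal_of {:L}} :=
  [set s in G | (u%:E <= upper_index s)%E]%SET.

Definition lower_break : R :=
  inf [set i : R | 0 <= i /\ lower_group i = 1%g].

Definition upper_break : R :=
  inf [set u : R | 0 <= u /\ upper_group u = 1%g].

End Ramification.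

Definition separable_closure (k ks : fieldType) (iota : {rmorphism k -> ks}) :
    Prop :=
  (forall x : ks, exists2 P : {poly k},
     separable_poly P & root (map_poly iota P) x) /\
  (forall P : {poly ks}, separable_poly P -> (1 < size P)%N ->
     exists x, root P x).

Section AbsoluteGaloisGroup.
Variables (k ks : fieldType) (iota : {rmorphism k -> ks}).

Definition is_kaut (s : ks -> ks) : Prop :=
  [/\ zmod_morphism s, monoid_morphism s, bijective s
    & forall a, s (iota a) = iota a].

Record abs_gal := AbsGal { ag_fun :> ks -> ks; ag_kaut : is_kaut ag_fun }.

Lemma abs_gal_inj (s t : abs_gal) : s =1 t -> s = t.
Proof.
case: s t => [s ps] [t pt] /= /funext st; move: ps pt; rewrite st => ps pt.
by congr AbsGal; exact: Prop_irrelevance.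
Qed.

HB.instance Definition _ := gen_eqMixin abs_gal.
HB.instance Definition _ := gen_choiceMixin abs_gal.

Fact kaut_id : is_kaut id.
Proof. by split=> //; exists id. Qed.

Fact kaut_comp (s t : abs_gal) : is_kaut (s \o t).
Proof.
case: s t => [s [s1 [s2 s3] s4 s5]] [t [t1 [t2 t3] t4 t5]] /=.
split.
- by move=> x y /=; rewrite t1 s1.
- by split=> [|x y] /=; rewrite ?t2 ?s2 ?t3 ?s3.
- exact: ssrfun.bij_comp.
- by move=> a /=; rewrite t5 s5.
Qed.

Fact kaut_inv_ex (s : abs_gal) : {t : abs_gal | cancel s t & cancel t s}.
Proof.
apply: cid2; case: s => s [s1 [s2 s3] [t st ts] s5] /=.
suff tP : is_kaut t by exists (AbsGal tP).
split.
- by move=> x y; rewrite -{1}[x]ts -{1}[y]ts -s1 st.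
- split; first by rewrite -s2 st.
  by move=> x y; rewrite -{1}[x]ts -{1}[y]ts -s3 st.
- by exists s.
- by move=> a; rewrite -{1}(s5 a) st.
Qed.

Definition ag_one := AbsGal kaut_id.
Definition ag_mul (s t : abs_gal) := AbsGal (kaut_comp s t).
Definition ag_inv (s : abs_gal) := s2val (kaut_inv_ex s).

Fact ag_mulA : associative ag_mul.
Proof. by move=> s t u; apply: abs_gal_inj. Qed.
Fact ag_mul1 : left_id ag_one ag_mul.
Proof. by move=> s; apply: abs_gal_inj. Qed.
Fact ag_mulr1 : right_id ag_one ag_mul.
Proof. by move=> s; apply: abs_gal_inj. Qed.
Fact ag_mulV : left_inverse ag_one ag_inv ag_mul.
Proof.
by move=> s; apply: abs_gal_inj => x /=; rewrite /ag_inv; case: kaut_inv_ex.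
Qed.
Fact ag_mulrV : right_inverse ag_one ag_inv ag_mul.
Proof.
by move=> s; apply: abs_gal_inj => x /=; rewrite /ag_inv; case: kaut_inv_ex.
Qed.

HB.instance Definition _ := isGroup.Build abs_gal
  ag_mulA ag_mul1 ag_mulr1 ag_mulV ag_mulrV.

(* Continuity from the Krull topology to a discrete space: a neighbourhood basis
   of [s] is given by the sets of those [t] that agree with [s] on a finite
   subset of [ks] (equivalently, on a finite subextension). *)
Definition krull_continuous (T : Type) (chi : abs_gal -> T) : Prop :=
  forall s : abs_gal, exists S : seq ks,
    forall t : abs_gal, {in S, s =1 t} -> chi t = chi s.

(* Hom_cont(G_k, H) = 1, for a subgroup H of a finite group. *)
Definition Hom_cont_trivial (gT : finGroupType) (H : {set gT}) : Prop :=
  forall chi : {multiplicative abs_gal -> gT},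
    krull_continuous chi -> (forall s, chi s \in H) ->
    forall s, chi s = 1%g.

End AbsoluteGaloisGroup.

(* Main.v *)
(* Let i be the largest finite value of i(s) = v(s piL - piL), H the group where
   i(s) >= i, and c a power of piL with v(c) = i. Since v(f(b)) is the value at
   max_s v(b - s piL) of the Herbrand function i |-> sum_s min(i, i(s)), and
   v_K(f, g) = v(f(b)) for every root b of g, the polynomials g with v_K(f, g) >= u
   are those having a root piL + c x with x integral. After scaling, g(piL + c X)
   reduces to A + w over k, where A is the product of the X - theta(s), s in H,
   theta(s) is the residue of (s piL - piL) / c, and w runs through k as g varies
   (w with A(-1) + w = 0 being excluded in the tame case). By Hensel's lemma in L,
   M_g is isomorphic to L if and only if A + w has a root in k.
   Now H acts faithfully on the affine line by y |-> theta(s) + psi(s) y, with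
   psi(s) the residue of s c / c: by translations in the wild case, by homotheties
   centred at -1 in the tame case. The roots of A + w form one free H-orbit, so a
   root y gives a homomorphism chi : G_k -> H with s y = chi(s) . y, and by Hilbert
   90 every chi arises in this way; chi is trivial if and only if y lies in k. *)
From HB Require Import structures.
Require Import Defs.
From mathcomp Require Import all_boot all_order all_algebra all_fingroup.
From mathcomp Require Import ring lra zify.
From mathcomp Require Import all_solvable all_field.
From mathcomp Require Import all_classical all_reals all_analysis.
Set Implicit Arguments.
Unset Strict Implicit.
Unset Printing Implicit Defensive.
Import Order.TTheory GRing.Theory Num.Theory.
Local Open Scope ring_scope.

(** The tool behind every statement on L is orthogonality: the nonzero terms a_l [piL]^l, l < e, of
    an element have values distinct modulo the integers, so the value of the sum is the minimum of
    theirs. It yields the Galois invariance of the valuation, the residue field k, completeness, and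
    the indices i(s) read off on [piL] alone. It also explains why g - f contributes a single
    scalar: writing u = q + l/e with 0 <= l < e determines l, so only the coefficient of X^l can
    reach the value u exactly. The obstacle is that the tame and wild cases call for two forms of
    Hilbert 90, multiplicative and additive, and for two kinds of equations. Both are packed into
    one affine action with one family of resolvents, so that the orbit arguments are made once; the
    cases separate only where a fixed point or a normal form is needed. On the side of G_k, two
    facts are required: there are enough automorphisms to have k as fixed field, and a continuous
    chi factors through a finite quotient. *)

(** * Irreducible polynomials and roots in an extension field *)

Lemma irredp_root_dvdp (F E : fieldType) (i : {rmorphism F -> E})
    (m q : {poly F}) x :
  irreducible_poly m -> root (map_poly i m) x ->
  root (map_poly i q) x = (m %| q).
Proof.
move=> irr_m mx; apply/idP/idP => [qx|/dvdpP[r ->]]; last first.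
  by rewrite rmorphM rootM mx orbT.
(* A gcd is unchanged by extension of the base field, so the common root [x] makes [gcdp m q]
   nonconstant over [F]. *)
have gx : root (map_poly i (gcdp m q)) x by rewrite gcdp_map root_gcd mx qx.
have m0 := irredp_neq0 irr_m.
have g0 : gcdp m q != 0 by rewrite gcdp_eq0 negb_and m0.
have g1 : size (gcdp m q) != 1%N.
  rewrite -(size_map_poly i) gtn_eqF //; apply: root_size_gt1 gx.
  by rewrite map_poly_eq0.
have := irr_m.2 _ g1 (dvdp_gcdl m q).
by rewrite /eqp => /andP[_ mg]; exact: dvdp_trans mg (dvdp_gcdr m q).
Qed.

Lemma irreducible_factor (F : fieldType) (p : {poly F}) :
  (1 < size p)%N -> exists2 m, irreducible_poly m & m %| p.
Proof.
have [n le_n] := ubnP (size p); elim: n p le_n => // n IH p le_n p1.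
have [irr|red] := pselect (irreducible_poly p); first by exists p.
have p0 : p != 0 by rewrite -size_poly_eq0 -lt0n ltnW.
have [q [q1 qp nqp]] : exists q : {poly F}, [/\ size q != 1%N, q %| p & ~~ (q %= p)].
  apply: contrapT => no; apply: red; split=> // q q1 qp.
  by apply/negP => /negP nqp; apply: no; exists q.
have q0 : q != 0 by apply: contraNneq p0 => q0; move: qp; rewrite q0 dvd0p.
have qs : (size q < size p)%N.
  by rewrite ltn_neqAle (dvdp_leq p0 qp) andbT dvdp_size_eqp.
have [||m irr_m mq] := IH q; first exact: leq_trans qs _.
  by case: (size q) (size_poly_gt0 q) q1 => [|[|?]]; rewrite q0.
by exists m => //; exact: dvdp_trans mq qp.
Qed.

Lemma root_irreducible_factor (F E : fieldType) (i : {rmorphism F -> E})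
    (p : {poly F}) x : p != 0 -> root (map_poly i p) x ->
  exists m, [/\ irreducible_poly m, m %| p & root (map_poly i m) x].
Proof.
have [n le_n] := ubnP (size p); elim: n p le_n => // n IH p le_n p0 px.
have p1 : (1 < size p)%N.
  by rewrite -(size_map_poly i); apply: root_size_gt1 px; rewrite map_poly_eq0.
have [m irr_m mp] := irreducible_factor p1.
have [mx|mx] := boolP (root (map_poly i m) x); first by exists m.
have Dp : p = p %/ m * m by rewrite divpK.
have qp : p %/ m %| p by rewrite {2}Dp dvdp_mulr.
have q0 : p %/ m != 0 by apply: contraNneq p0 => q0; rewrite Dp q0 mul0r.
have [|||m' [i' d' r']] := IH (p %/ m) => //.
- apply: (@leq_trans (size p)); last by rewrite -ltnS.
  rewrite size_divp ?irredp_neq0 // -[X in (_ < X)%N]subn0 ltn_sub2l ?(ltnW p1) //.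
  by rewrite -subn1 subn_gt0 irr_m.1.
- by move: px; rewrite {1}Dp rmorphM rootM (negPf mx) orbF.
by exists m'; split=> //; exact: dvdp_trans qp.
Qed.

(** * Automorphisms of a separable closure *)

Section GraphExtension.
Variables (k ks : fieldType) (iota : {rmorphism k -> ks}).
Local Open Scope classical_set_scope.

(* Partial k-automorphisms of ks are handled through their graphs, so that the
   union of a chain needs no gluing of functions. *)
Record kgraph (G : set (ks * ks)) : Prop := KGraph {
  kgraph_base : forall a, G (iota a, iota a);
  kgraphB : forall a b, G a -> G b -> G (a - b);
  kgraphM : forall a b, G a -> G b -> G (a * b);
  kgraphV : forall a, G a -> G (a.1^-1, a.2^-1);
  kgraph_eq0 : forall a, G a -> (a.1 == 0) = (a.2 == 0) }.

Section Extend.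
Variables (G : set (ks * ks)) (gG : kgraph G).

Definition kgraph_pred : {pred ks * ks} := [pred a | `[< G a >]].

Fact kgraph_subring : subring_closed kgraph_pred.
Proof.
split=> [|a b|a b]; rewrite !inE.
- by have := kgraph_base gG 1; rewrite rmorph1; exact.
- exact: kgraphB.
- exact: kgraphM.
Qed.
HB.instance Definition _ :=
  GRing.isSubringClosed.Build (ks * ks)%type kgraph_pred kgraph_subring.

(** A graph is itself a field, with two embeddings [pr1] and [pr2] into [ks]. A polynomial over it
    is a polynomial over the domain of the partial automorphism together with its transport to the
    image. *)
Record kgraph_of := KGraphOf { kg_val :> ks * ks; _ : kg_val \in kgraph_pred }.
HB.instance Definition _ := [isSub for kg_val].
HB.instance Definition _ := [Choice of kgraph_of by <:].
HB.instance Definition _ := [SubChoice_isSubComNzRing of kgraph_of by <:].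

Lemma kgraph_ofP (a : kgraph_of) : G (kg_val a).
Proof. by case: a => a /=; rewrite inE. Qed.

Fact kgraph_inv_subproof (a : kgraph_of) :
  ((kg_val a).1^-1, (kg_val a).2^-1) \in kgraph_pred.
Proof. by rewrite inE; apply/(kgraphV gG)/kgraph_ofP. Qed.
Definition kgraph_inv (a : kgraph_of) := KGraphOf (kgraph_inv_subproof a).

Fact kgraph_fieldP (a : kgraph_of) : a != 0 -> kgraph_inv a * a = 1.
Proof.
move=> a0; apply/val_inj => /=.
have := kgraph_eq0 gG (kgraph_ofP a).
have : kg_val a != 0 by apply: contra a0 => /eqP a0; apply/eqP/val_inj.
case: (kg_val a) => x y /= xy0 exy.
have x0 : x != 0.
  apply: contra xy0 => /eqP x0; rewrite x0 eqxx in exy.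
  by apply/eqP; rewrite x0 (eqP (esym exy)).
by rewrite -[LHS]/(x^-1 * x, y^-1 * y) !mulVf // -exy.
Qed.
Fact kgraph_inv0 : kgraph_inv 0 = 0.
Proof. by apply/val_inj; rewrite /= !invr0. Qed.
HB.instance Definition _ :=
  GRing.ComNzRing_isField.Build kgraph_of kgraph_fieldP kgraph_inv0.

Let pr1 : {rmorphism kgraph_of -> ks} := fst \o val.
Let pr2 : {rmorphism kgraph_of -> ks} := snd \o val.

Fact kgraph_of_base_subproof a : (iota a, iota a) \in kgraph_pred.
Proof. by rewrite inE; exact: (kgraph_base gG). Qed.
Definition kgraph_of_base a := KGraphOf (kgraph_of_base_subproof a).
Fact kgraph_of_base_zmod : zmod_morphism kgraph_of_base.
Proof. by move=> a b; apply/val_inj; rewrite /= !rmorphB. Qed.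
Fact kgraph_of_base_monoid : monoid_morphism kgraph_of_base.
Proof. by split=> [|a b]; apply/val_inj; rewrite /= ?rmorphM ?rmorph1. Qed.
HB.instance Definition _ :=
  GRing.isZmodMorphism.Build k kgraph_of kgraph_of_base kgraph_of_base_zmod.
HB.instance Definition _ :=
  GRing.isMonoidMorphism.Build k kgraph_of kgraph_of_base kgraph_of_base_monoid.

(** The new graph consists of the pairs of values of q at [x] and of its transport at [y]. By
    irreducibility either value vanishes exactly when [m] divides q, so the graph is again
    single-valued and injective. *)
Lemma kgraph_extend_root (m : {poly kgraph_of}) x y :
  irreducible_poly m -> root (map_poly pr1 m) x -> root (map_poly pr2 m) y ->
  exists G', [/\ kgraph G', G `<=` G' & G' (x, y)].
Proof.
move=> irr_m mx my.
pose ev (q : {poly kgraph_of}) : ks * ks := ((map_poly pr1 q).[x], (map_poly pr2 q).[y]).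
have ev0 q : ((ev q).1 == 0) = ((ev q).2 == 0).
  by have := irredp_root_dvdp q irr_m mx;
     have := irredp_root_dvdp q irr_m my; rewrite /root => -> ->.
have evC a : ev a%:P = kg_val a.
  by rewrite /ev !map_polyC !hornerC; case: a => [[]].
exists [set ev q | q in [set: {poly kgraph_of}]]; split; last first.
- by exists 'X => //; rewrite /ev !map_polyX !hornerX.
- move=> a Ga; have aG : a \in kgraph_pred by rewrite inE.
  by exists (KGraphOf aG)%:P.
split.
- by move=> a; exists (kgraph_of_base a)%:P.
- by move=> _ _ [q _ <-] [r _ <-]; exists (q - r); rewrite // /ev !rmorphB !hornerE.
- by move=> _ _ [q _ <-] [r _ <-]; exists (q * r); rewrite // /ev !rmorphM !hornerE.
- move=> _ [q _ <-]; have q02 := ev0 q; have [q0|q0] := boolP ((ev q).1 == 0).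
    move: q02; rewrite q0 => /esym q02; rewrite /ev /= in q0 q02 *.
    exists 0 => //=; rewrite !map_poly0 !horner0 (eqP q0) (eqP q02) invr0 //.
  (* Inverting [q] modulo [m] gives a polynomial [w], so the pairs of polynomial values are closed
     under inversion. *)
  have /Bezout_eq1_coprimepP[[u w] /= uw] : coprimep m q.
    rewrite coprimep_def; apply: contraNT q0 => /irr_m.2/(_ (dvdp_gcdl m q)).
    move=> /andP[_ mg]; have : m %| q by apply: dvdp_trans mg (dvdp_gcdr _ _).
    by rewrite -(irredp_root_dvdp q irr_m mx).
  have H : ev w * ev q = 1.
    have -> : ev w * ev q = ev (w * q) by rewrite /ev !rmorphM !hornerM.
    have -> : w * q = 1 - u * m by rewrite -uw addrC addKr.
    by rewrite /ev !rmorphB !rmorphM !rmorph1 !hornerE (rootP mx) (rootP my) !mulr0 subr0.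
  suff ev_w : ev w = ((ev q).1^-1, (ev q).2^-1) by exists w.
  move: q02 q0 H; case: (ev q) (ev w) => a b [c d] /= ab a0 [ca db].
  have b0 : b != 0 by rewrite -ab.
  by congr pair; [apply: (mulIf a0) | apply: (mulIf b0)]; rewrite ?ca ?db mulVf.
- by move=> _ [q _ <-].
Qed.

Hypothesis ks_closure : separable_closure iota.

Lemma kgraph_extend x : exists G' y, [/\ kgraph G', G `<=` G' & G' (x, y)].
Proof.
have [P sepP Px] := ks_closure.1 x.
pose PG := map_poly kgraph_of_base P.
have PGx : root (map_poly pr1 PG) x.
  by rewrite -map_poly_comp (@eq_map_poly _ _ _ iota).
have sepPG : separable_poly PG by rewrite separable_map.
have [m [irr_m mP mx]] :=
  root_irreducible_factor (separable_poly_neq0 sepPG) PGx.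
have [||y my] := ks_closure.2 (map_poly pr2 m).
- by rewrite separable_map (dvdp_separable mP).
- by rewrite size_map_poly; exact: irr_m.1.
by have [G' ?] := kgraph_extend_root irr_m mx my; exists G', y.
Qed.

(** As [x] is outside the domain, its minimal polynomial [m] has degree at least 2; being separable,
    it has a second root [y]. On a diagonal graph [m] is its own transport, so [x] may be sent to
    [y]. *)
Lemma kgraph_extend_neq x : (forall a, G a -> a.1 = a.2) ->
  (forall y, ~ G (x, y)) ->
  exists G' y, [/\ kgraph G', G `<=` G', G' (x, y) & y != x].
Proof.
move=> Gdiag xG; have [P sepP Px] := ks_closure.1 x.
pose PG := map_poly kgraph_of_base P.
have PGx : root (map_poly pr1 PG) x.
  by rewrite -map_poly_comp (@eq_map_poly _ _ _ iota).
have sepPG : separable_poly PG by rewrite separable_map.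
have [m [irr_m mP mx]] :=
  root_irreducible_factor (separable_poly_neq0 sepPG) PGx.
have Dm : map_poly pr2 m = map_poly pr1 m.
  by apply: eq_map_poly => a; rewrite /= -(Gdiag _ (kgraph_ofP a)).
have [q Dq] := factor_theorem _ _ mx.
have : separable_poly (q * ('X - x%:P)).
  by rewrite -Dq separable_map (dvdp_separable mP).
rewrite separable_root => /andP[sepq qx].
have [|y qy] := ks_closure.2 q sepq.
  have := size_map_poly pr1 m; rewrite Dq size_mul ?polyXsubC_eq0 ?separable_poly_neq0 //.
  rewrite size_XsubC addn2 /= => sz; rewrite ltnNge -ltnS sz; apply/negP => m2.
  have {}m2 : size m = 2%N by apply/eqP; rewrite eqn_leq m2; exact: irr_m.1.
  have [r mr] := poly2_root m2.
  have mXr : m %| 'X - r%:P.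
    rewrite -(irredp_root_dvdp (i := pr1) (x := pr1 r) _ irr_m).
      by rewrite map_polyXsubC root_XsubC.
    by rewrite /root horner_map (rootP mr) rmorph0.
  have := irredp_root_dvdp ('X - r%:P) irr_m mx; rewrite mXr map_polyXsubC root_XsubC.
  move=> /eqP xr; apply: (xG (kg_val r).2); rewrite xr.
  by rewrite -[pr1 r]/(kg_val r).1 -surjective_pairing; exact: kgraph_ofP.
have my : root (map_poly pr2 m) y by rewrite Dm Dq rootM qy.
have [G' [gG' GG' G'xy]] := kgraph_extend_root irr_m mx my.
by exists G', y; split=> //; apply: contraNneq qx => <-.
Qed.

End Extend.

Hypothesis ks_closure : separable_closure iota.

Lemma kgraph_swap (G : set (ks * ks)) :
  kgraph G -> kgraph [set a | G (a.2, a.1)].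
Proof.
move=> [Gb GB GM GV G0]; split=> //= [a b|a b|a|a].
- by move=> Ga Gb'; exact: (GB _ _ Ga Gb').
- by move=> Ga Gb'; exact: (GM _ _ Ga Gb').
- exact: GV.
- by move=> /G0 /= ->.
Qed.

Lemma kgraph_total_aut (G : set (ks * ks)) : kgraph G ->
  (forall x, exists y, G (x, y)) -> (forall y, exists x, G (x, y)) ->
  exists s : abs_gal iota, forall x y, G (x, y) -> s x = y.
Proof.
move=> gG Gl Gr.
have Gfun x y y' : G (x, y) -> G (x, y') -> y = y'.
  move=> Gy Gy'; have := kgraph_eq0 gG (kgraphB gG Gy Gy').
  by rewrite /= subrr eqxx => /esym; rewrite subr_eq0 => /eqP.
have Ginj x x' y : G (x, y) -> G (x', y) -> x = x'.
  move=> Gy Gy'; have := kgraph_eq0 gG (kgraphB gG Gy Gy').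
  by rewrite /= subrr eqxx subr_eq0 => /eqP.
have [s sP] := choice Gl; have [t tP] := choice Gr.
have s_aut : is_kaut iota s.
  split.
  - move=> x y; apply: (Gfun (x - y)) => //.
    exact: (kgraphB gG (sP x) (sP y)).
  - split=> [|x y].
      by apply: (Gfun 1) => //; rewrite -(rmorph1 iota); exact: kgraph_base.
    by apply: (Gfun (x * y)) => //; exact: (kgraphM gG (sP x) (sP y)).
  - by exists t => x; [apply: Ginj (tP _) (sP _) | apply: Gfun (sP _) (tP _)].
  - by move=> a; apply: (Gfun (iota a)) => //; exact: kgraph_base.
by exists (AbsGal s_aut) => x y; apply: Gfun.
Qed.

(** A maximal graph is total by [kgraph_extend], and onto by the same lemma applied to the swapped
    graph. *)
Lemma kgraph_abs_gal (G : set (ks * ks)) : kgraph G ->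
  exists s : abs_gal iota, forall x y, G (x, y) -> s x = y.
Proof.
move=> gG.
pose P X := X = set0 \/ kgraph X /\ G `<=` X.
have [F FP Ftot|A [PA maxA]] := @Zorn_bigcup _ P.
  have [[X FX X0]|F0] := pselect (exists2 X, F X & X <> set0); last first.
    left; rewrite -subset0 => a [X FX Xa]; apply: F0; exists X => // X0.
    by rewrite X0 in Xa.
  have gF Y : F Y -> Y <> set0 -> kgraph Y /\ G `<=` Y by move=> /FP [].
  have [gX GX] := gF _ FX X0; right.
  have pair a b : (\bigcup_(Y in F) Y) a -> (\bigcup_(Y in F) Y) b ->
      exists Y, [/\ F Y, kgraph Y, Y a & Y b].
    move=> [Y FY Ya] [Z FZ Zb].
    have gY : kgraph Y by apply: (gF _ FY _).1 => Y0; rewrite Y0 in Ya.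
    have gZ : kgraph Z by apply: (gF _ FZ _).1 => Z0; rewrite Z0 in Zb.
    by case: (Ftot _ _ FY FZ) => [YZ|ZY]; [exists Z; split=> //; exact: YZ|exists Y;
      split=> //; exact: ZY].
  split; last by move=> a Ga; exists X => //; exact: GX.
  split.
  - by move=> a; exists X => //; exact: kgraph_base.
  - by move=> a b aF /(pair _ _ aF) [Y [FY gY Ya Yb]]; exists Y => //; exact: kgraphB.
  - by move=> a b aF /(pair _ _ aF) [Y [FY gY Ya Yb]]; exists Y => //; exact: kgraphM.
  - by move=> a aF; have [Y [FY gY Ya _]] := pair _ _ aF aF; exists Y => //; exact: kgraphV.
  - by move=> a aF; have [Y [FY gY Ya _]] := pair _ _ aF aF; exact: kgraph_eq0 gY _ Ya.
have G0 : G !=set0 by exists (iota 0, iota 0); exact: kgraph_base.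
have [A0|[gA GA]] := PA.
  case: (maxA G); last by right; split.
  by split; [rewrite A0; exact: sub0set|case: G0 => a Ga /(_ _ Ga); rewrite A0].
have max B : kgraph B -> A `<=` B -> B `<=` A.
  move=> gB AB; apply: contrapT => BA; apply: (maxA B) => //.
  by right; split=> //; exact: subset_trans AB.
have [| |s sP] := kgraph_total_aut gA.
- move=> x; have [B [y [gB AB Bxy]]] := kgraph_extend gA ks_closure x.
  by exists y; exact: max Bxy.
- move=> y; have [B [x [gB AB Bxy]]] := kgraph_extend (kgraph_swap gA) ks_closure y.
  exists x; apply: (max _ (kgraph_swap gB) _ (x, y) Bxy).
  by case=> a b Aab; exact: AB.
- by exists s => x y /GA; exact: sP.
Qed.

Lemma abs_gal_fixed_field x :
  (forall s : abs_gal iota, s x = x) -> exists a, iota a = x.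
Proof.
move=> fix_x; apply: contrapT => xk.
pose G := [set (iota a, iota a) | a in [set: k]].
have gG : kgraph G.
  split.
  - by move=> a; exists a.
  - by move=> _ _ [a _ <-] [b _ <-]; exists (a - b) => //; rewrite rmorphB.
  - by move=> _ _ [a _ <-] [b _ <-]; exists (a * b) => //; rewrite rmorphM.
  - by move=> _ [a _ <-]; exists a^-1 => //; rewrite fmorphV.
  - by move=> _ [a _ <-].
have [|y|G' [y [gG' _ G'xy yx]]] := @kgraph_extend_neq G gG ks_closure x.
- by move=> _ [a _ <-].
- by case=> a _ [ax _]; apply: xk; exists a.
have [s sP] := kgraph_abs_gal gG'.
by rewrite -(sP _ _ G'xy) fix_x eqxx in yx.
Qed.

End GraphExtension.

(** * Independence of characters and resolvents over finite quotients of G_k *)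

(** Dedekind's argument, relative to a multiplicatively closed [M] that separates the characters. In
    the application [M] is a finite subextension, on which representatives of distinct classes of
    automorphisms differ. *)
Lemma character_independence (E : fieldType) (M : E -> Prop) (I : finType)
    (c : I -> E -> E) (a : I -> E) :
  M 1 -> (forall x y, M x -> M y -> M (x * y)) ->
  (forall i, monoid_morphism (c i)) ->
  (forall i j, i != j -> exists2 x, M x & c i x != c j x) ->
  (forall x, M x -> \sum_i a i * c i x = 0) -> forall i, a i = 0.
Proof.
move=> M1 MM cM c_neq.
have [n le_n] := ubnP #|[set i | a i != 0]|.
elim: n a le_n => // n IH a le_n sum0 i0; apply/eqP/negPn/negP => ai0.
have [j aj ji0] : exists2 j, a j != 0 & j != i0.
  apply: contrapT => no; move/eqP: ai0; apply.
  have := sum0 1 M1; rewrite (bigD1 i0) //= (cM i0).1 mulr1 big1 ?addr0 // => j ji0.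
  have [->|aj] := eqVneq (a j) 0; first by rewrite mul0r.
  by case: no; exists j.
have [u Mu cu] := c_neq _ _ ji0.
(* Subtracting [c i0 u] times the relation at x from the relation at [u * x] kills the term [i0] and
   shortens the relation, while the term [j] survives. *)
have /(_ j)/eqP : forall i, a i * (c i u - c i0 u) = 0.
  apply: IH => [|x Mx].
    rewrite -ltnS (leq_trans _ le_n) // ltnS; apply: proper_card.
    apply/properP; split.
      by apply/fintype.subsetP => i; rewrite !inE; apply: contra => /eqP ->; rewrite mul0r.
    by exists i0; rewrite !inE // subrr mulr0 eqxx.
  have := sum0 _ (MM _ _ Mu Mx).
  have -> : \sum_i a i * c i (u * x) = \sum_i a i * (c i u * c i x).
    by apply: eq_bigr => i _; rewrite (cM i).2.
  move=> e; have D i : a i * (c i u - c i0 u) * c i x =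
      a i * (c i u * c i x) - c i0 u * (a i * c i x).
    by rewrite mulrBr mulrBl !mulrA (mulrC (c i0 u)).
  rewrite (eq_bigr _ (fun i _ => D i)).
  by rewrite sumrB -mulr_sumr e sum0 // mulr0 subrr.
by rewrite mulf_eq0 (negPf aj) subr_eq0 (negPf cu).
Qed.

Lemma root_seq (E : fieldType) (P : {poly E}) : P != 0 ->
  exists Z : seq E, forall x, (x \in Z) = root P x.
Proof.
have [n le_n] := ubnP (size P); elim: n P le_n => // n IH P le_n P0.
have [[x Px]|no] := pselect (exists x, root P x); last first.
  exists [::] => x; rewrite in_nil; apply/esym/negbTE/negP => Px.
  by apply: no; exists x.
have [Q DP] := factor_theorem _ _ Px.
have Q0 : Q != 0 by apply: contraNneq P0 => Q0; rewrite DP Q0 mul0r.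
have [|Z ZQ] := IH Q _ Q0.
  by move: le_n; rewrite DP size_mul ?polyXsubC_eq0 // size_XsubC addn2.
by exists (x :: Z) => y; rewrite inE ZQ DP rootM root_XsubC orbC.
Qed.

Section AbsGalAction.
Variables (k ks : fieldType) (iota : {rmorphism k -> ks}).
Notation Gk := (abs_gal iota).
Implicit Types s t r : Gk.

Fact abs_gal_zmod s : zmod_morphism s. Proof. by case: s => s []. Qed.
Fact abs_gal_monoid s : monoid_morphism s. Proof. by case: s => s []. Qed.
HB.instance Definition _ s :=
  GRing.isZmodMorphism.Build ks ks (ag_fun s) (abs_gal_zmod s).
HB.instance Definition _ s :=
  GRing.isMonoidMorphism.Build ks ks (ag_fun s) (abs_gal_monoid s).

Lemma abs_gal_base s a : s (iota a) = iota a. Proof. by case: s => s []. Qed.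

Lemma abs_galM s t x : (s * t)%g x = s (t x). Proof. by []. Qed.

Lemma abs_galVK s x : (s^-1)%g (s x) = x.
Proof. by rewrite -abs_galM mulVg. Qed.

Lemma abs_galKV s x : s ((s^-1)%g x) = x.
Proof. by rewrite -abs_galM mulgV. Qed.

Lemma abs_gal_root s (P : {poly k}) x :
  root (map_poly iota P) x -> root (map_poly iota P) (s x).
Proof.
move=> Px; have -> : map_poly iota P = map_poly s (map_poly iota P).
  by rewrite -map_poly_comp; apply: eq_map_poly => a /=; rewrite abs_gal_base.
by rewrite /root horner_map (rootP Px) rmorph0.
Qed.

Hypothesis ks_closure : separable_closure iota.

(** G_k permutes the finitely many roots in [ks] of a polynomial over k that vanishes on [S]. *)
Lemma abs_gal_stable_seq (S : seq ks) : exists2 Z : seq ks,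
  {subset S <= Z} & forall s x, x \in Z -> s x \in Z.
Proof.
have [P PP] := choice (fun x => let: ex_intro2 P a b := ks_closure.1 x in
  ex_intro (fun P => separable_poly P /\ root (map_poly iota P) x) P (conj a b)).
pose Q := \prod_(x <- S) P x.
have Q0 : Q != 0.
  by rewrite prodf_seq_neq0; apply/allP => x _; exact: separable_poly_neq0 (PP x).1.
have [|Z ZQ] := @root_seq _ (map_poly iota Q); first by rewrite map_poly_eq0.
exists Z => [x xS|s x]; rewrite !ZQ; last exact: abs_gal_root.
rewrite /Q (big_rem x) //= rmorphM rootM; apply/orP; left.
exact: (PP x).2.
Qed.

(** By Galois theory this is the subextension k(Z), described through automorphisms only. *)
Definition fixed_by (Z : seq ks) x := forall s, {in Z, forall z, s z = z} -> s x = x.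

(* I is the finite quotient of Gk acting faithfully on Z; [rep] chooses representatives. *)
Lemma abs_gal_finite_quotient (S : seq ks) :
  exists (Z : seq ks) (I : finType) (rep : I -> Gk) (cls : Gk -> I),
  [/\ {subset S <= Z}, cancel rep cls
    & forall s t, cls s = cls t <-> {in Z, s =1 t}].
Proof.
have [Z SZ Zst] := abs_gal_stable_seq S.
pose T := seq_sub Z.
pose restr s : {ffun T -> T} := [ffun z => SeqSub (Zst s _ (ssvalP z))].
pose I := {g : {ffun T -> T} | `[< exists s, restr s = g >]}.
have clsP s : `[< exists t, restr t = restr s >] by apply/asboolP; exists s.
pose cls s : I := exist _ (restr s) (clsP s).
have repE (i : I) : exists s, restr s = val i by apply/asboolP; exact: (valP i).
have [rep repP] := choice repE.
exists Z, I, rep, cls; split=> // [i|s t]; first by apply: val_inj; exact: repP.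
split=> [[] /ffunP est z zZ|st].
  by have := congr1 val (est (SeqSub zZ)); rewrite !ffunE.
apply: val_inj; apply/ffunP => z; apply: val_inj; rewrite !ffunE /=.
exact/st/ssvalP.
Qed.

Section Resolvent.
Variables (gT : finGroupType) (chi : {multiplicative Gk -> gT}).
Hypothesis chi_cont : krull_continuous chi.

(** The sums run over a finite quotient through which [chi] factors, so applying r permutes the
    summands and translates F; independence of characters makes some sum nonzero. A general F covers
    both the multiplicative resolvent (F the inverse of psi) and the additive one (F = theta). *)
Lemma resolvents : exists (I : finType) (rep : I -> Gk) (B : ks -> Prop),
  (forall (F : gT -> k) x r, B x ->
     r (\sum_i iota (F (chi (rep i))) * rep i x)
     = \sum_i iota (F ((chi r)^-1 * chi (rep i))%g) * rep i x) /\
  (forall F : gT -> k, (forall s, F (chi s) != 0) ->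
     exists2 x, B x & \sum_i iota (F (chi (rep i))) * rep i x != 0).
Proof.
have [S chiS] := chi_cont 1%g.
have [Z [I [rep [cls [SZ repK clsP]]]]] := abs_gal_finite_quotient S.
exists I, rep, (fixed_by Z).
have eq_on s t x : cls s = cls t -> fixed_by Z x -> s x = t x.
  move=> /clsP st fx; have /(congr1 t) : (t^-1 * s)%g x = x.
    by apply: fx => z zZ; rewrite abs_galM st // abs_galVK.
  by rewrite abs_galM abs_galKV.
have eq_chi s t : cls s = cls t -> chi s = chi t.
  move=> /clsP st; have : chi (t^-1 * s)%g = chi 1%g.
    apply: chiS => z /SZ zZ; by rewrite abs_galM st // abs_galVK.
  by move=> e; rewrite -(mulVKg t s) gmulfM e -gmulfM mulg1.
have clsM r s t : cls s = cls t -> cls (r * s)%g = cls (r * t)%g.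
  by move=> /clsP st; apply/clsP => z zZ; rewrite !abs_galM st.
split=> [F x r Bx|F F0].
  rewrite rmorph_sum /=.
  pose tr r i := cls (r * rep i)%g.
  have trK r' : cancel (tr r') (tr (r'^-1)%g).
    by move=> i; rewrite /tr (clsM _ _ (r' * rep i)%g) ?repK // mulKg repK.
  have tr_bij : bijective (tr r).
    by exists (tr (r^-1)%g) => //; rewrite -{2}(invgK r).
  rewrite [RHS](reindex (tr r)) /=; last exact: onW_bij.
  apply: eq_bigr => i _; rewrite rmorphM /= abs_gal_base -abs_galM.
  have -> : chi (rep (tr r i)) = (chi r * chi (rep i))%g.
    by rewrite -gmulfM; apply: eq_chi; rewrite repK.
  rewrite mulKg; congr (_ * _).
  by apply: eq_on; rewrite ?repK.
have [i0|I0] := pickP I; last by have := I0 (cls 1%g).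
apply: contrapT => no.
suff /eqP : iota (F (chi (rep i0))) = 0 by rewrite fmorph_eq0 (negPf (F0 _)).
apply: (@character_independence _ (fixed_by Z) I (fun i => rep i)
  (fun i => iota (F (chi (rep i))))).
- by move=> s _; exact: rmorph1.
- by move=> x y Mx My s sZ; rewrite rmorphM /= (Mx s sZ) (My s sZ).
- by move=> i; exact: abs_gal_monoid.
- move=> i j ij; apply: contrapT => same.
  move/eqP: ij; apply; rewrite -(repK i) -(repK j); apply/clsP => z zZ.
  by apply: contrapT => /eqP zij; apply: same; exists z => // s; exact.
- move=> x Bx; apply: contrapT => /eqP x0; apply: no; exists x => //.
Qed.

End Resolvent.
End AbsGalAction.

(** * Torsors under affine actions *)

Section AffineAction.
Variables (k : fieldType) (gT : finGroupType) (H : {group gT}).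
Variables (theta psi : gT -> k).

(* The maps y |-> theta s + psi s * y form a faithful (right) action of H on the
   affine line, by translations or by homotheties centred at -1. *)
Record affine_action : Prop := AffineAction {
  affine_psi1 : psi 1%g = 1;
  affine_psiM : {in H &, forall s t, psi (s * t)%g = psi s * psi t};
  affine_thetaM : {in H &, forall s t, theta (s * t)%g = theta t + psi t * theta s};
  affine_inj : {in H, forall s, theta s = 0 -> s = 1%g};
  affine_split : {in H, forall s, psi s = 1} \/ {in H, forall s, theta s = psi s - 1} }.

Definition aff (E : fieldType) (i : {rmorphism k -> E}) s y : E :=
  i (theta s) + i (psi s) * y.

Definition aff_poly : {poly k} := \prod_(s in H) ('X - (theta s)%:P).

Definition aff_free (E : fieldType) (i : {rmorphism k -> E}) y :=
  {in H, forall s, aff i s y = y -> s = 1%g}.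

(* The common fixed point -1 of the homotheties is not a root of [aff_poly + w],
   so that all roots have trivial stabiliser. *)
Definition aff_nondeg w :=
  {in H, forall s, psi s = 1} \/ ~~ root (aff_poly + w%:P) (-1).

Hypothesis affA : affine_action.

Lemma psi_expg s n : s \in H -> psi (s ^+ n)%g = psi s ^+ n.
Proof.
move=> sH; elim: n => [|n IH]; first by rewrite expg0 expr0 (affine_psi1 affA).
by rewrite expgS exprS (affine_psiM affA) ?groupX // IH.
Qed.

Lemma psi_exp_card s : s \in H -> psi s ^+ #|H| = 1.
Proof. by move=> sH; rewrite -psi_expg // expg_cardG // (affine_psi1 affA). Qed.

Lemma psi_neq0 s : s \in H -> psi s != 0.
Proof.
move=> sH; apply/eqP => s0; have := psi_exp_card sH.
by rewrite s0 expr0n -leqn0 leqNgt cardG_gt0 => /eqP; rewrite eq_sym oner_eq0.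
Qed.

Lemma theta1 : theta 1%g = 0.
Proof.
have := affine_thetaM affA (group1 H) (group1 H).
by rewrite mulg1 affine_psi1 // mul1r => /eqP; rewrite -subr_eq subrr eq_sym => /eqP.
Qed.

Section Extension.
Variables (E : fieldType) (i : {rmorphism k -> E}).

Lemma affM s t y : s \in H -> t \in H -> aff i (s * t)%g y = aff i t (aff i s y).
Proof.
move=> sH tH; rewrite /aff affine_thetaM ?affine_psiM // rmorphD !rmorphM.
by rewrite mulrDr !mulrA addrA (mulrC (i (psi s))).
Qed.

Lemma aff1 y : aff i 1%g y = y.
Proof. by rewrite /aff theta1 affine_psi1 // rmorph0 rmorph1 mul1r add0r. Qed.

Lemma aff_sub s y z : aff i s y - aff i s z = i (psi s) * (y - z).
Proof. by rewrite /aff opprD addrACA subrr add0r mulrBr. Qed.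

Lemma aff_base s a : aff i s (i a) = i (theta s + psi s * a).
Proof. by rewrite /aff rmorphD rmorphM. Qed.

Lemma aff_poly_hornerE y :
  (map_poly i aff_poly).[y] = \prod_(s in H) (y - i (theta s)).
Proof.
rewrite rmorph_prod horner_prod; apply: eq_bigr => s _ /=.
by rewrite map_polyXsubC hornerXsubC.
Qed.

(** Since theta(t s) = theta(s) + psi(s) theta(t), the factor of index t s at [aff i s y] is psi(s)
    times the factor of index t at [y], and psi(s) to the power [#|H|] is 1. *)
Lemma aff_poly_inv s y : s \in H ->
  (map_poly i aff_poly).[aff i s y] = (map_poly i aff_poly).[y].
Proof.
move=> sH; rewrite !aff_poly_hornerE.
rewrite (reindex_inj (mulIg s)) /=.
rewrite (eq_big (fun t => t \in H) (fun t => i (psi s) * (y - i (theta t)))).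
- by rewrite big_split /= prodr_const -rmorphXn psi_exp_card // rmorph1 mul1r.
- by move=> t; rewrite groupMr.
move=> t; rewrite groupMr // => tH.
by rewrite -aff_sub aff_base affine_thetaM.
Qed.

Lemma aff_root w s y : s \in H ->
  root (map_poly i (aff_poly + w%:P)) (aff i s y)
  = root (map_poly i (aff_poly + w%:P)) y.
Proof.
by move=> sH; rewrite /root rmorphD /= map_polyC !hornerD !hornerC aff_poly_inv.
Qed.

Lemma aff_inj_free y : aff_free i y -> {in H &, injective (fun s => aff i s y)}.
Proof.
move=> fy s t sH tH /= st; have /fy : aff i (s * t^-1)%g y = y.
  by rewrite affM ?groupV // st -affM ?groupV // mulgV aff1.
by rewrite groupM ?groupV // => /(_ isT)/eqP; rewrite -eq_mulgV1 => /eqP.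
Qed.

Lemma size_aff_poly0 : size aff_poly = #|H|.+1.
Proof. by rewrite /aff_poly -big_enum size_prod_XsubC -cardE. Qed.

Lemma size_polyC_aff w : (size (w%:P : {poly k}) < size aff_poly)%N.
Proof.
by rewrite size_aff_poly0 (leq_ltn_trans (size_polyC_leq1 _)) // ltnS cardG_gt0.
Qed.

Lemma aff_poly_monic w : aff_poly + w%:P \is monic.
Proof.
have mA : aff_poly \is monic by apply: monic_prod => s _; exact: monicXsubC.
by rewrite monicE lead_coefDl ?(monicP mA) // size_polyC_aff.
Qed.

Lemma size_aff_poly w : size (aff_poly + w%:P) = #|H|.+1.
Proof. by rewrite size_polyDl ?size_polyC_aff // size_aff_poly0. Qed.

Definition aff_orbit y := [seq aff i s y | s <- enum H].

Lemma aff_orbit_uniq y : aff_free i y -> uniq (aff_orbit y).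
Proof.
move=> fy; rewrite map_inj_in_uniq ?enum_uniq // => s t.
by rewrite !mem_enum; exact: aff_inj_free.
Qed.

(** The free orbit of [y] consists of roots and already has as many elements as the degree. *)
Lemma aff_poly_split w y : aff_free i y ->
  root (map_poly i (aff_poly + w%:P)) y ->
  map_poly i (aff_poly + w%:P) = \prod_(a <- aff_orbit y) ('X - a%:P).
Proof.
move=> fy ry; have mA : map_poly i (aff_poly + w%:P) \is monic.
  by rewrite map_monic aff_poly_monic.
rewrite [LHS](@all_roots_prod_XsubC _ _ (aff_orbit y)).
- by rewrite (monicP mA) scale1r.
- by rewrite size_map_poly size_aff_poly size_map -cardE.
- by apply/allP => x /mapP [s]; rewrite mem_enum => sH ->; rewrite aff_root.
- by rewrite uniq_rootsE aff_orbit_uniq.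
Qed.

(** A translation with a fixed point is trivial, and a nontrivial homothety fixes only its centre
    -1. *)
Lemma nondeg_free w y : aff_nondeg w ->
  root (map_poly i (aff_poly + w%:P)) y -> aff_free i y.
Proof.
move=> nd ry s sH; have [psi1|deg] := affine_split affA.
  rewrite /aff psi1 // rmorph1 mul1r => /eqP;
    rewrite -[X in _ == X]add0r (inj_eq (addIr y)).
  by rewrite fmorph_eq0 => /eqP; exact: affine_inj.
have [psi1|ns] := nd.
  move=> _; apply: (affine_inj affA) => //.
  by rewrite deg // psi1 // subrr.
rewrite /aff deg // rmorphB rmorph1 => /eqP; rewrite -subr_eq0.
have -> : i (psi s) - 1 + i (psi s) * y - y = (i (psi s) - 1) * (y - i (-1)).
  by rewrite rmorphN1; ring.
rewrite mulf_eq0 -(rmorph1 i) -rmorphB -deg // fmorph_eq0.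
case/orP => [/eqP|]; first exact: affine_inj.
by rewrite subr_eq0 => /eqP y1; rewrite y1 fmorph_root in ry; rewrite ry in ns.
Qed.

End Extension.

(** Separability can be tested after adjoining one root, whose free orbit splits the polynomial into
    distinct factors. *)
Lemma aff_poly_separable w : aff_nondeg w -> separable_poly (aff_poly + w%:P).
Proof.
move=> nd; have [|m irr_m mp] := @irreducible_factor _ (aff_poly + w%:P).
  by rewrite size_aff_poly ltnS cardG_gt0.
have [E _ [z mz _]] := irredp_FAdjoin irr_m.
have ry : root (map_poly (in_alg E) (aff_poly + w%:P)) z.
  by rewrite (irredp_root_dvdp _ irr_m mz).
have fz := nondeg_free nd ry.
rewrite -(separable_map (in_alg E)) (aff_poly_split fz ry).
by rewrite separable_prod_XsubC aff_orbit_uniq.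
Qed.

Variables (ks : fieldType) (iota : {rmorphism k -> ks}).
Hypothesis ks_closure : separable_closure iota.

Lemma nondeg_root w : Hom_cont_trivial iota H -> aff_nondeg w ->
  exists a, root (aff_poly + w%:P) a.
Proof.
move=> triv nd.
have [||y ry] := ks_closure.2 (map_poly iota (aff_poly + w%:P)).
- by rewrite separable_map aff_poly_separable.
- by rewrite size_map_poly size_aff_poly ltnS cardG_gt0.
have fy := nondeg_free nd ry.
have chiP (s : abs_gal iota) : exists h, h \in H /\ s y = aff iota h y.
  have : root (map_poly iota (aff_poly + w%:P)) (s y) by exact: abs_gal_root.
  rewrite (aff_poly_split fy ry) root_prod_XsubC => /mapP [h].
  by rewrite mem_enum => hH ->; exists h.
have [chi /all_and2 [chiH chiE]] := choice chiP.
have chiM : {morph chi : s t / (s * t)%g >-> (s * t)%g}.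
  (* Elements of G_k commute with the affine maps, which are defined over k; this exchanges [chi s]
     and [chi t], and the right action exchanges them back. Hence a homomorphism and not an
     antihomomorphism. *)
  move=> s t; apply: (aff_inj_free fy); rewrite ?groupM //=.
  rewrite affM // -!chiE abs_galM (chiE t) /aff rmorphD rmorphM /=.
  by rewrite !abs_gal_base chiE.
pose chiM' := isMultiplicative.Build (abs_gal iota) gT chi chiM.
pose X : {multiplicative abs_gal iota -> gT} := HB.pack chi chiM'.
have fix_y (s : abs_gal iota) : s y = y.
  rewrite chiE -[RHS](aff1 iota); congr aff.
  apply: (triv X) => // {}s; exists [:: y] => t /(_ y); rewrite inE eqxx => /(_ isT) st.
  by apply: (aff_inj_free fy); rewrite //= -!chiE st.
have [a ay] := abs_gal_fixed_field ks_closure fix_y.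
by exists a; rewrite -(fmorph_root iota) ay.
Qed.

(* Hilbert 90 in its additive or multiplicative form, according to the two cases
   of [affine_split], turns a homomorphism chi into a torsor under H. *)
Lemma aff_torsor (chi : {multiplicative abs_gal iota -> gT}) :
  krull_continuous chi -> (forall s, chi s \in H) ->
  exists y w, [/\ aff_nondeg w, root (map_poly iota (aff_poly + w%:P)) y
    & forall s : abs_gal iota, s y = aff iota (chi s) y].
Proof.
move=> chi_cont chiH.
have [I [rep [B [trans nz]]]] := resolvents ks_closure chi_cont.
(* In the tame case [z] solves multiplicative Hilbert 90. In the wild case psi = 1 and [z] is a
   nonzero trace, used below as a denominator. *)
have [|x Bx] := nz (fun g => (psi g)^-1).
  by move=> s; rewrite invr_eq0 psi_neq0.
set z := \sum_i _ => z0.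
have sz (s : abs_gal iota) : s z = iota (psi (chi s)) * z.
  rewrite (trans (fun g => (psi g)^-1)) // mulr_sumr; apply: eq_bigr => i _.
  rewrite affine_psiM ?groupV // invfM !rmorphM mulrA; congr (_ * _ * _).
  apply: (mulfI (_ : iota (psi (chi s)^-1)%g != 0)).
    by rewrite fmorph_eq0 psi_neq0 // groupV.
  rewrite -!rmorphM mulfV ?psi_neq0 ?groupV // -affine_psiM ?groupV //.
  by rewrite mulVg affine_psi1.
suff [y sy fy] : exists2 y, (forall s : abs_gal iota, s y = aff iota (chi s) y)
    & {in H, forall s, psi s = 1} \/ {in H, forall s, theta s = psi s - 1} /\ y != -1.
  (* The value at [y] is invariant by [aff_poly_inv], hence lies in k; its opposite is the constant
     w. *)
  have [a ay] : exists a, iota a = (map_poly iota aff_poly).[y].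
    apply: (abs_gal_fixed_field ks_closure) => s.
    rewrite -horner_map /= sy -map_poly_comp (@eq_map_poly _ _ _ iota) ?aff_poly_inv //.
    by move=> a /=; rewrite abs_gal_base.
  have ry : root (map_poly iota (aff_poly + (- a)%:P)) y.
    by rewrite /root polyCN rmorphB /= map_polyC hornerD hornerN hornerC /= ay subrr.
  exists y, (- a); split=> //; case: fy => [?|[deg y1]]; [by left | right].
  have fy : aff_free iota y.
    move=> s sH /eqP; rewrite /aff deg // rmorphB rmorph1 -subr_eq0.
    have -> : iota (psi s) - 1 + iota (psi s) * y - y
              = (iota (psi s) - 1) * (y - -1) by ring.
    rewrite mulf_eq0 [y - _ == 0]subr_eq0 (negPf y1) orbF -(rmorph1 iota) -rmorphB.
    by rewrite -deg // fmorph_eq0 => /eqP; exact: affine_inj.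
  rewrite -(fmorph_root iota) (aff_poly_split fy ry) root_prod_XsubC rmorphN1.
  apply/mapP => -[s]; rewrite mem_enum => sH /eqP.
  rewrite /aff deg // rmorphB rmorph1 -subr_eq0.
  have -> : -1 - (iota (psi s) - 1 + iota (psi s) * y)
              = - iota (psi s) * (y - -1) by ring.
  by rewrite mulf_eq0 oppr_eq0 fmorph_eq0 (negPf (psi_neq0 sH)) subr_eq0 (negPf y1).
have [psi1|deg] := affine_split affA; last first.
  (* Subtracting 1 moves the centre of the homotheties from 0 to -1. *)
  exists (z - 1); last first.
    by right; split=> //; rewrite -subr_eq0 opprK subrK.
  move=> s; rewrite rmorphB rmorph1 /= sz /aff deg // rmorphB rmorph1.
  by ring.
(* Translation of theta gives s u = u - theta(chi s) z with z fixed by s, whence the sign in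
   [- u / z]. *)
pose u := \sum_i iota (theta (chi (rep i))) * rep i x.
exists (- u / z); last by left.
move=> s; rewrite fmorph_div rmorphN /= sz psi1 // rmorph1 mul1r.
rewrite (trans theta) // /aff psi1 // rmorph1 mul1r.
have -> : \sum_i iota (theta ((chi s)^-1 * chi (rep i))%g) * rep i x
  = u - iota (theta (chi s)) * z.
  rewrite /u /z mulr_sumr -sumrB; apply: eq_bigr => i _.
  rewrite psi1 // invr1 rmorph1 mul1r -mulrBl -rmorphB; congr (iota _ * _).
  have := affine_thetaM affA (chiH s) (_ : (chi s)^-1 * chi (rep i) \in H)%g.
  rewrite mulKVg psi1 ?groupM ?groupV // mul1r => /(_ isT) ->.
  by rewrite addrK.
by rewrite opprB mulrBl mulfK // mulNr.
Qed.

Theorem Hom_cont_trivialP :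
  Hom_cont_trivial iota H <->
  (forall w, aff_nondeg w -> exists a, root (aff_poly + w%:P) a).
Proof.
split=> [triv w|all_roots chi chi_cont chiH s]; first exact: nondeg_root.
have [y [w [nd ry sy]]] := aff_torsor chi_cont chiH.
have [a ra] := all_roots w nd.
have ra' : root (map_poly iota (aff_poly + w%:P)) (iota a) by rewrite fmorph_root.
(* The affine maps are defined over k, so one root in k puts all of them there. Then [s] fixes [y],
   and freeness forces [chi s] to be 1. *)
have := ry; rewrite (aff_poly_split (nondeg_free nd ra') ra') root_prod_XsubC.
case/mapP => h hH ya; apply: (nondeg_free nd ry) => //.
by rewrite -sy ya aff_base // abs_gal_base.
Qed.

End AffineAction.

(** * Valuations and Eisenstein polynomials *)

Section ValuationLemmas.
Variables (R : realType) (F : fieldType) (v : valuation R F).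

Lemma val_fin x : x != 0 -> v x = (fine (v x))%:E.
Proof.
move=> x0; rewrite fineK // fin_numE valuation_neqNy; apply/negP => /eqP vx.
by have := valuation_eqy v x; rewrite vx eqxx (negPf x0).
Qed.

Lemma val_neq0 x r : v x = r%:E -> x != 0.
Proof. by move=> vx; rewrite -(valuation_eqy v) vx. Qed.

Lemma val_sum_ge (I : Type) (r : seq I) (P : pred I) (G : I -> F) (a : \bar R) :
  (forall i, P i -> (a <= v (G i))%E) -> (a <= v (\sum_(i <- r | P i) G i)%R)%E.
Proof.
move=> aG; apply: (big_ind (fun x => a <= v x)%E) => //.
- by rewrite valuation0 leey.
- by move=> x y ax ay; apply: le_trans (valuationD v x y); rewrite le_min ax.
Qed.

Lemma val_sum_gt (I : Type) (r : seq I) (P : pred I) (G : I -> F) (a : R) :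
  (forall i, P i -> (a%:E < v (G i))%E) -> (a%:E < v (\sum_(i <- r | P i) G i)%R)%E.
Proof.
move=> aG; apply: (big_ind (fun x => a%:E < v x)%E) => //.
- by rewrite valuation0 ltey.
- by move=> x y ax ay; apply: lt_le_trans (valuationD v x y); rewrite lt_min ax.
Qed.

Lemma valM_fin x y a b : v x = a%:E -> v y = b%:E -> v (x * y) = (a + b)%:E.
Proof. by rewrite valuationM => -> ->. Qed.

Lemma valX_fin x a n : v x = a%:E -> v (x ^+ n) = (a *+ n)%:E.
Proof.
move=> vx; elim: n => [|n IH]; first by rewrite expr0 valuation1.
by rewrite exprS (valM_fin vx IH) mulrS.
Qed.

Lemma valV_fin x a : v x = a%:E -> v x^-1 = (- a)%:E.
Proof.
move=> vx; have x0 := val_neq0 vx.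
have := valuationM v x x^-1; rewrite mulfV // valuation1 vx.
rewrite [v x^-1]val_fin ?invr_eq0 //= -EFinD => -[] /eqP.
by rewrite eq_sym addr_eq0 => /eqP ->; rewrite opprK.
Qed.

Lemma val_div_fin x y a b : v x = a%:E -> v y = b%:E -> v (x / y) = (a - b)%:E.
Proof. by move=> vx /valV_fin; exact: valM_fin. Qed.

Lemma val_div_ge x y b c : v y = b%:E -> ((b + c)%:E <= v x)%E ->
  (c%:E <= v (x / y)%R)%E.
Proof.
have [->|x0] := eqVneq x 0; first by rewrite mul0r valuation0 !leey.
rewrite (val_fin x0) => vy; rewrite (val_div_fin (val_fin x0) vy) !lee_fin; lra.
Qed.

Lemma val_div_gt x y b c : v y = b%:E -> ((b + c)%:E < v x)%E ->
  (c%:E < v (x / y)%R)%E.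
Proof.
have [->|x0] := eqVneq x 0; first by rewrite mul0r valuation0 !ltey.
rewrite (val_fin x0) => vy; rewrite (val_div_fin (val_fin x0) vy) !lte_fin; lra.
Qed.

Lemma val_prod_fin (I : Type) (r : seq I) (P : pred I) (G : I -> F) (a : I -> R) :
  (forall i, P i -> v (G i) = (a i)%:E) ->
  v (\prod_(i <- r | P i) G i) = (\sum_(i <- r | P i) a i)%:E.
Proof.
move=> vG; rewrite -sumEFin; apply: (big_ind2 (fun x y => v x = y)) => //.
- exact: valuation1.
- by move=> x1 y1 x2 y2 <- <-; exact: valuationM.
Qed.

Lemma valB x y : (Order.min (v x) (v y) <= v (x - y)%R)%E.
Proof. by have := valuationD v x (- y); rewrite valuationN. Qed.

Lemma valD_lt x y : (v x < v y)%E -> v (x + y) = v x.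
Proof.
move=> xy; apply/le_anti/andP; split.
  have := valB (x + y) y; rewrite addrK ge_min => /orP [//|yx].
  by have := lt_le_trans xy yx; rewrite ltxx.
by have := valuationD v x y; rewrite min_l // ltW.
Qed.

Lemma val_sum_distinct (I : eqType) (r : seq I) (G : I -> F) : uniq r ->
  {in r &, forall i j, i != j -> v (G i) = v (G j) -> G i = 0} ->
  v (\sum_(i <- r) G i) = \big[Order.min/+oo%E]_(i <- r) v (G i).
Proof.
elim: r => [|i r IH] /=; first by rewrite !big_nil valuation0.
case/andP => ir ur dist; rewrite !big_cons.
have {}IH : v (\sum_(j <- r) G j) = \big[Order.min/+oo%E]_(j <- r) v (G j).
  by apply: IH => // j l jr lr; apply: dist; rewrite inE ?jr ?lr orbT.
have [ltij|ltij|eqij] := ltgtP (v (G i)) (v (\sum_(j <- r) G j)).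
- by rewrite -IH valD_lt // min_l // ltW.
- by rewrite -IH addrC valD_lt // min_r // ltW.
(* In a tie the tail takes its value at some term j, and the hypothesis on i and j makes [G i]
   vanish. *)
have Gi0 : G i = 0.
  have [S0|S0] := eqVneq (\sum_(j <- r) G j) 0.
    by apply/eqP; rewrite -(valuation_eqy v) eqij S0 valuation0.
  have [j jr vj] : exists2 j, j \in r & v (\sum_(j <- r) G j) = v (G j).
    have : v (\sum_(j <- r) G j) != +oo%E by rewrite valuation_eqy.
    rewrite IH; elim: (r) => [|j s IHs]; first by rewrite big_nil eqxx.
    rewrite big_cons; case: leP => [_ _|_ /IHs [l ls ->]]; first by exists j;
      rewrite // inE eqxx.
    by exists l; rewrite // inE ls orbT.
  apply: (dist i j); rewrite ?inE ?eqxx ?jr ?orbT // -?vj //.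
  by apply: contraNneq ir => ->.
by rewrite -IH Gi0 add0r valuation0 min_r ?leey.
Qed.

End ValuationLemmas.

Section EisensteinEvaluation.
Variables (R : realType) (K : fieldType) (vK : valuation R K).
Hypothesis vK_discrete : normalized_discrete vK.

Lemma vK_int a : a != 0 -> exists n : int, vK a = (n%:~R)%:E.
Proof.
move=> a0; have : [set vK x | x in [set x : K | x != 0]]%classic (vK a) by exists a.
by rewrite [X in X _]vK_discrete => -[n _ <-]; exists n; rewrite mulr1n divr1.
Qed.

Lemma vK_surj (n : int) : exists a, vK a = (n%:~R)%:E.
Proof.
have : [set ((m%:~R / 1%:R)%:E : \bar R) | m in [set: int]]%classic (n%:~R)%:E.
  by exists n; rewrite // mulr1n divr1.
by rewrite -[X in X _]vK_discrete => -[a _ <-]; exists a.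
Qed.

(** This turns a bound v(a) + l/e >= 0 with l < e into integrality of the coefficient a. *)
Lemma vK_gtN1 a : ((-1)%:E < vK a)%E -> (0 <= vK a)%E.
Proof.
have [->|a0] := eqVneq a 0; first by rewrite valuation0 leey.
have [n ->] := vK_int a0; rewrite lte_fin lee_fin => n1.
have : (-1)%:~R < (n%:~R : R) by apply: le_lt_trans n1; rewrite rmorphN1.
by rewrite ltr_int ler0z; lia.
Qed.

Variables (E : fieldType) (v : valuation R E) (i : {rmorphism K -> E}).
Hypothesis v_ext : forall a, v (i a) = vK a.
Variables (e : nat) (e_gt0 : (0 < e)%N).

(* The valuations of the nonzero terms are pairwise distinct modulo the integers. *)
Lemma val_horner x (h : {poly K}) : v x = (e%:R^-1)%:E -> (size h <= e)%N ->
  v (map_poly i h).[x] = \big[Order.min/+oo%E]_(l < e) (vK h`_l + (l%:R / e%:R)%:E)%E.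
Proof.
move=> vx sh; rewrite (horner_coef_wide x (n := e)) ?size_map_poly //.
have vt (l : 'I_e) : v ((map_poly i h)`_l * x ^+ l) = (vK h`_l + (l%:R / e%:R)%:E)%E.
  by rewrite coef_map valuationM v_ext (valX_fin _ vx) mulr_natl.
rewrite val_sum_distinct ?index_enum_uniq //.
  by apply: eq_bigr => l _; rewrite vt.
move=> l m _ _ lm; rewrite !vt.
have [hl0|hl0] := eqVneq h`_l 0; first by rewrite coef_map /= hl0 rmorph0 mul0r.
have [hm0|hm0] := eqVneq h`_m 0.
  by have [n ->] := vK_int hl0; rewrite hm0 valuation0.
have [n ->] := vK_int hl0; have [n' ->] := vK_int hm0; rewrite -!EFinD => -[nm].
have e0 : (e%:R : R) != 0 by rewrite pnatr_eq0 -lt0n.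
have : ((n * e%:Z + l%:Z)%:~R : R) = (n' * e%:Z + m%:Z)%:~R.
  by apply: (mulIf (invr_neq0 e0)); rewrite !intrD !intrM !mulrDl !mulfK.
move/intr_inj => nm'; case/eqP: lm; apply: val_inj => /=.
have l_e := ltn_ord l; have m_e := ltn_ord m; move: nm'.
have [->|[|]] : n = n' \/ n + 1 <= n' \/ n' + 1 <= n by lia.
- lia.
- nia.
- nia.
Qed.

(** Solve for x^e in g(x) = 0. If v(x) <= 0, the other terms would have value at least 1 + e v(x),
    more than that of x^e. So v(x) > 0, the constant term strictly dominates the others, and e v(x)
    = 1. *)
Lemma eisenstein_root_val g x :
  eisenstein vK e g -> root (map_poly i g) x -> v x = (e%:R^-1)%:E.
Proof.
move=> [mg sg gi g0] gx.
have ve : v (x ^+ e) = v (\sum_(l < e) i g`_l * x ^+ l).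
  have := rootP gx; rewrite (horner_coef_wide x (n := e.+1)) ?size_map_poly ?sg //.
  rewrite big_ord_recr /= coef_map.
  have -> : g`_e = 1 by have := monicP mg; rewrite /lead_coef sg.
  rewrite /= rmorph1 mul1r => /eqP; rewrite addr_eq0 => /eqP xe.
  rewrite -valuationN -xe; congr (v _); apply: eq_bigr => l _.
  by rewrite coef_map.
have x0 : x != 0.
  apply: contraTneq gx => ->; rewrite /root horner_coef0 coef_map.
  by rewrite -(valuation_eqy v) v_ext g0.
have vx := val_fin v x0; set r := fine (v x) in vx.
have vt (l : 'I_e) : ((1 + r *+ l)%:E <= v (i g`_l * x ^+ l)%R)%E.
  by rewrite valuationM v_ext (valX_fin _ vx) EFinD leeD2r // gi.
rewrite (valX_fin _ vx) in ve.
have r0 : 0 < r.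
  rewrite ltNge; apply/negP => r0.
  have : ((1 + r *+ e)%:E <= (r *+ e)%:E)%E.
    rewrite ve; apply: val_sum_ge => l _; apply: le_trans (vt l).
    rewrite lee_fin lerD2l -[r *+ e]mulr_natl -[r *+ l]mulr_natl ler_wnM2r // ler_nat;
      exact: ltnW.
  by rewrite lee_fin; lra.
have : v (\sum_(l < e) i g`_l * x ^+ l) = 1%:E.
  case: (e) e_gt0 vt => // n _ vt; rewrite big_ord_recl expr0 mulr1 valD_lt v_ext g0 //.
  apply: val_sum_gt => l _; apply: lt_le_trans (vt _).
  by rewrite lte_fin ltrDl pmulrn_lgt0.
rewrite -ve => -[re]; rewrite vx; congr (_%:E).
by apply: (mulIf (_ : e%:R != 0));
  rewrite ?pnatr_eq0 -?lt0n // mulVf ?pnatr_eq0 -?lt0n // mulr_natr.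
Qed.

Lemma eisenstein_size_sub g h : eisenstein vK e g -> eisenstein vK e h ->
  (size (g - h)%R <= e)%N.
Proof.
move=> [mg sg _ _] [mh sh _ _].
apply/leq_sizeP => l el; rewrite coefB; have [->|ltel] := eqVneq l e.
  by have := monicP mg; have := monicP mh; rewrite /lead_coef sg sh /= => -> ->;
    rewrite subrr.
have {el ltel}el : (e < l)%N by rewrite ltn_neqAle eq_sym ltel.
by rewrite !nth_default ?subrr ?sg ?sh.
Qed.

End EisensteinEvaluation.

(** * Ramification breaks and reduction at the last break *)

Section RamificationFunctions.
Variables (R : realType) (K : fieldType) (L : splittingFieldType K).
Variable vL : valuation R L.
Notation G := ('Gal({:L} / 1))%g.
Local Open Scope classical_set_scope.

Lemma measurable_le_ereal (x : \bar R) :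
  measurable ([set t : R | (t%:E <= x)%E] : set (measurableTypeR R)).
Proof.
case: x => [r| |].
- rewrite (_ : mkset _ = `]-oo, r]); first exact: measurable_itv.
  by apply/seteqP; split=> t /=; rewrite in_itv /= lee_fin.
- rewrite (_ : mkset _ = setT); first exact: measurableT.
  by apply/seteqP; split=> t // _ /=; exact: leey.
- rewrite (_ : mkset _ = set0); first exact: measurable0.
  by apply/seteqP; split=> t.
Qed.

Lemma lebesgue_measure_0_ereal (x : \bar R) : (0 <= x)%E ->
  lebesgue_measure [set t : R | 0 <= t /\ (t%:E <= x)%E] = x.
Proof.
case: x => [r| |] //= x0.
- rewrite (_ : mkset _ = `[0, r]) ?lebesgue_measure_itv /=; last first.
    by apply/seteqP; split=> t /=; rewrite in_itv /= lee_fin; [case=> -> -> | case/andP].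
  rewrite lte_fin; case: ltP => r0; first by rewrite sube0.
  by rewrite lee_fin in x0; congr (_%:E); apply/le_anti; rewrite r0 x0.
- rewrite (_ : mkset _ = `[0, +oo[) ?lebesgue_measure_itv /= ?ltry //.
  by apply/seteqP; split=> t /=; rewrite in_itv /= andbT; [case | rewrite leey].
Qed.

(** The integrand is the sum over s of the indicators of t <= i(s), so s contributes the length of
    the interval from 0 to min(x, i(s)). *)
Lemma ram_phiE (x : \bar R) : (0 <= x)%E -> (forall s, 0 <= lower_index vL s)%E ->
  ram_phi vL x = (\sum_(s in G) Order.min x (lower_index vL s))%E.
Proof.
move=> x0 li0; rewrite /ram_phi; set D := [set t | _].
have mD : measurable D.
  rewrite (_ : D = `[0, +oo[ `&` [set t : R | (t%:E <= x)%E]).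
    by apply: measurableI; [exact: measurable_itv | exact: measurable_le_ereal].
  by apply/seteqP; split=> t /=; rewrite in_itv /= andbT.
pose A s := [set t : R | (t%:E <= lower_index vL s)%E].
have mA s : measurable (A s) by exact: measurable_le_ereal.
transitivity (\int[lebesgue_measure]_(t in D) (\sum_(s <- enum G) (\1_(A s) t)%:E))%E.
  apply: eq_integral => t _; rewrite big_enum /= sumEFin; congr (_%:E).
  rewrite /lower_group -sum1dep_card natr_sum big_mkcondr /=; apply: eq_bigr => s _.
  by rewrite indicE /A; case: ifPn => ts; [rewrite mem_set|rewrite memNset //; exact/negP].
rewrite ge0_integral_sum //; last first.
  move=> s; apply/measurable_realfun.measurable_EFinP.
  by apply: measurable_realfun.measurable_indic; exact: mA.
rewrite big_enum; apply: eq_bigr => s _; rewrite integral_indic //; last exact: mA.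
rewrite (_ : _ `&` _ = [set t : R | 0 <= t /\ (t%:E <= Order.min x (lower_index vL s))%E]).
  by apply: lebesgue_measure_0_ereal; rewrite le_min x0 li0.
apply/seteqP; split=> t; rewrite /D /A /= le_min.
  by move=> [ts [t0 tx]]; split=> //; rewrite tx ts.
by move=> [t0 /andP [tx ts]]; split.
Qed.

(** The ramification groups are cut out by non-strict inequalities, so they are trivial strictly
    beyond the last break and nontrivial at the break itself. *)
Lemma inf_gt (S : set R) (x : R) : (forall y, S y <-> x < y) -> inf S = x.
Proof.
move=> Sx; rewrite (_ : S = `]x, +oo[) ?inf_itv //.
by apply/seteqP; split=> y /=; rewrite in_itv /= andbT => /Sx.
Qed.

Lemma mem_gal1 (s : gal_of {:L}) : s \in G.
Proof.
by rewrite -finset.sub1set galois_connection ?sub1v.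
Qed.

End RamificationFunctions.

(** * Expansions in powers of a uniformizer *)

Section TotallyRamified.
Variables (R : realType) (K : fieldType) (vK : valuation R K).
Hypothesis vK_discrete : normalized_discrete vK.
Variables (L : splittingFieldType K) (w : valuation R L).
Hypothesis w_ext : forall a : K, w a%:A = vK a.
Notation e := (\dim {:L}).
Hypothesis L_totram : value_group_frac w e.
Variable piL : L.
Hypothesis piL_unif : uniformizer w piL.
Variable f : {poly K}.
Hypothesis f_eis : eisenstein vK e f.
Hypothesis f_min : map_poly (in_alg L) f = minPoly 1%AS piL.

Notation inL := (map_poly (in_alg L)).

Lemma dimL_gt0 : (0 < e)%N. Proof. exact: (adim_gt0 {:L}%AS). Qed.

Lemma dimR_gt0 : 0 < (e%:R : R). Proof. by rewrite ltr0n dimL_gt0. Qed.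

Lemma w_int x : x != 0 -> exists n : int, w x = (n%:~R / e%:R)%:E.
Proof.
move=> x0; have : [set w x | x in [set x : L | x != 0]]%classic (w x) by exists x.
by rewrite [X in X _]L_totram => -[n _ <-]; exists n.
Qed.

Lemma w_surj (n : int) : exists x, w x = (n%:~R / e%:R)%:E.
Proof.
have : [set ((m%:~R / e%:R)%:E : \bar R) | m in [set: int]]%classic (n%:~R / e%:R)%:E.
  by exists n.
by rewrite -[X in X _]L_totram => -[x _ <-]; exists x.
Qed.

Lemma w_pi : w piL = (e%:R^-1)%:E.
Proof.
have [pi_gt0 pi_min] := piL_unif; have [x wx] := w_surj 1.
rewrite mul1r in wx; have := pi_min x; rewrite wx lte_fin invr_gt0 dimR_gt0 => /(_ isT) le1.
have pi0 : piL != 0.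
  by apply: contraTneq le1 => ->; rewrite valuation0 leye_eq.
have [n wn] := w_int pi0; move: pi_gt0 le1; rewrite wn lte_fin lee_fin.
rewrite pmulr_lgt0 ?invr_gt0 ?dimR_gt0 // ltr0z => n0.
rewrite ler_pdivrMr ?dimR_gt0 // mulVf ?gt_eqF ?dimR_gt0 // => n1.
have {}n1 : n <= 1 by rewrite -(ler_int R).
by rewrite (_ : n = 1) ?mul1r //; lia.
Qed.

Lemma w_gt0 x : (0 < w x)%E -> ((e%:R^-1)%:E <= w x)%E.
Proof. by move=> x0; rewrite -w_pi; exact: piL_unif.2. Qed.

Lemma w_piX n : w (piL ^+ n) = (n%:R / e%:R)%:E.
Proof. by rewrite (valX_fin _ w_pi) mulr_natl. Qed.

Lemma pi_span x : exists2 h : {poly K}, (size h <= e)%N & x = (inL h).[piL].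
Proof.
have de : adjoin_degree 1%AS piL = e.
  have := size_minPoly 1%AS piL; rewrite -f_min size_map_poly.
  by have [_ -> _ _] := f_eis => -[].
have full : <<1; piL>>%VS = {:L}%VS.
  apply/eqP; rewrite eqEdim subvf dim_Fadjoin de dimv1 muln1 leqnn //.
have xin : x \in <<1%AS; piL>>%VS by rewrite full memvf.
have /polyOver1P [h Dh] := Fadjoin_polyOver 1%AS piL x.
exists h; last by rewrite -Dh Fadjoin_poly_eq.
by rewrite -(size_map_poly (in_alg L)) -Dh -de; exact: size_Fadjoin_poly.
Qed.

Lemma w_span (h : {poly K}) x : w x = (e%:R^-1)%:E -> (size h <= e)%N ->
  w (inL h).[x] = \big[Order.min/+oo%E]_(l < e) (vK h`_l + (l%:R / e%:R)%:E)%E.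
Proof. by move=> wx sh; apply: val_horner => //; exact: dimL_gt0. Qed.

Lemma w_coef_ge (h : {poly K}) (a : \bar R) : (size h <= e)%N ->
  (a <= w (inL h).[piL])%E ->
  forall l, (l < e)%N -> (a <= vK h`_l + (l%:R / e%:R)%:E)%E.
Proof.
move=> sh; rewrite w_span ?w_pi // => ah l le.
by apply: le_trans ah _; rewrite (bigD1 (Ordinal le)) //= ge_min lexx.
Qed.

Lemma w_root x : root (inL f) x -> w x = (e%:R^-1)%:E.
Proof. by apply: eisenstein_root_val f_eis => //; exact: dimL_gt0. Qed.

Lemma gal_alg (s : gal_of {:L}) (a : K) : s a%:A = a%:A.
Proof. by rewrite linearZ /= rmorph1. Qed.

Lemma gal_inL (s : gal_of {:L}) (h : {poly K}) x : s (inL h).[x] = (inL h).[s x].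
Proof.
rewrite -horner_map -map_poly_comp (@eq_map_poly _ _ _ (in_alg L)) //.
by move=> a /=; rewrite gal_alg.
Qed.

(** [s piL] is again a root of the Eisenstein polynomial [f], hence of value 1/e, and the value of h
    at a point of value 1/e depends only on the coefficients of h. *)
Lemma w_gal (s : gal_of {:L}) x : w (s x) = w x.
Proof.
have spi : root (inL f) (s piL).
  by rewrite /root -gal_inL f_min (rootP (root_minPoly _ _)) rmorph0.
have [h sh ->] := pi_span x.
by rewrite gal_inL !w_span ?w_pi // (w_root spi).
Qed.

(** * The residue field of L is that of K *)

Section ResidueField.
Variables (k : fieldType) (red : {rmorphism val_ring_of vK -> k}).
Hypothesis red_residue : residue_map red.

(** The lift is the constant coefficient of the expansion in [piL]: the other coefficients are
    integral too, so their terms have positive value. *)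
Lemma residue_lift_ex (x : val_ring_of w) :
  exists a : val_ring_of vK, (0 < w (val x - (val a)%:A)%R)%E.
Proof.
have [h sh xh] := pi_span (val x).
have x0 : (0 <= w (inL h).[piL])%E by rewrite -xh; exact: (valP x).
have ge := w_coef_ge sh x0.
have a0 : (0 <= vK h`_0)%E by have := ge 0%N dimL_gt0; rewrite mul0r adde0.
exists (ValRing a0); rewrite /= xh (horner_coef_wide _ (n := e)) ?size_map_poly //.
move: (e) dimL_gt0 w_piX ge => [//|n] _ wX ge.
rewrite big_ord_recl /= coef_map /= expr0 mulr1 addrC addKr.
apply: val_sum_gt => l _; rewrite coef_map valuationM w_ext wX.
have l0 : 0 < ((bump 0 l)%:R / n.+1%:R : R) by rewrite divr_gt0 ?ltr0n.
have l1 : (bump 0 l)%:R / n.+1%:R < 1 :> R.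
  by rewrite ltr_pdivrMr ?ltr0n // mul1r ltr_nat; exact: (ltn_ord (lift ord0 l)).
apply: (@lt_le_trans _ _ ((bump 0 l)%:R / n.+1%:R)%:E); first by rewrite lte_fin.
rewrite leeDr // (vK_gtN1 vK_discrete) //.
have /= := ge _ (ltn_ord (lift ord0 l)).
have [->|hl0] := eqVneq h`_(bump 0 l) 0; first by rewrite valuation0 ltey.
by rewrite (val_fin vK hl0) -EFinD lee_fin lte_fin; move: l1; set t := _ / _; lra.
Qed.

Definition residue_lift x := projT1 (cid (residue_lift_ex x)).

Lemma residue_liftP x : (0 < w (val x - (val (residue_lift x))%:A)%R)%E.
Proof. exact: (projT2 (cid (residue_lift_ex x))). Qed.

Definition redL (x : val_ring_of w) : k := red (residue_lift x).

Lemma redL_uniq x a : (0 < w (val x - (val a)%:A)%R)%E -> redL x = red a.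
Proof.
move=> xa; apply/eqP; rewrite -subr_eq0 -rmorphB; apply/eqP/red_residue.2.
rewrite -w_ext -[vr_val _]/(val _) rmorphB /= scalerBl.
have -> : (val (residue_lift x))%:A - (val a)%:A
        = (val x - (val a)%:A) - (val x - (val (residue_lift x))%:A) :> L by ring.
apply: lt_le_trans (valB _ _ _).
by rewrite lt_min xa residue_liftP.
Qed.

Fact redL_zmod : zmod_morphism redL.
Proof.
move=> x y; rewrite (@redL_uniq (x - y) (residue_lift x - residue_lift y)) ?rmorphB //=.
rewrite scalerBl.
have -> : val x - val y - ((val (residue_lift x))%:A - (val (residue_lift y))%:A)
   = (val x - (val (residue_lift x))%:A) - (val y - (val (residue_lift y))%:A) :> L by ring.
by apply: lt_le_trans (valB _ _ _); rewrite lt_min !residue_liftP.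
Qed.

Lemma mul_val_gt0 x y : (0 <= w x)%E -> (0 < w y)%E -> (0 < w (x * y)%R)%E.
Proof.
rewrite valuationM => x0 y0; apply: lt_le_trans y0 _.
by rewrite leeDr.
Qed.

Fact redL_monoid : monoid_morphism redL.
Proof.
split=> [|x y].
  rewrite (@redL_uniq 1 1) ?rmorph1 //= ?scale1r ?subrr ?valuation0 ?ltey //.
rewrite (@redL_uniq (x * y) (residue_lift x * residue_lift y)) ?rmorphM //=.
set a := val (residue_lift x); set b := val (residue_lift y).
have -> : val x * val y - (a * b)%:A
    = val x * (val y - b%:A) + b%:A * (val x - a%:A) :> L.
  have -> : (a * b)%:A = a%:A * b%:A :> L by rewrite -scalerAl mul1r scalerA.
  by ring.
apply: lt_le_trans (valuationD _ _ _); rewrite lt_min !mul_val_gt0 ?residue_liftP //.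
- by rewrite w_ext; exact: (valP (residue_lift y)).
- exact: (valP x).
Qed.

HB.instance Definition _ :=
  GRing.isZmodMorphism.Build (val_ring_of w) k redL redL_zmod.
HB.instance Definition _ :=
  GRing.isMonoidMorphism.Build (val_ring_of w) k redL redL_monoid.

Lemma redL_eq0 x : redL x = 0 <-> (0 < w (val x))%E.
Proof.
split=> [x0|x0]; last first.
  by rewrite (@redL_uniq x 0) ?rmorph0 //= scale0r subr0.
have /red_residue.2 a0 : red (residue_lift x) = 0 by [].
rewrite -[val x](subrK (val (residue_lift x))%:A).
by apply: lt_le_trans (valuationD _ _ _); rewrite lt_min residue_liftP w_ext.
Qed.

Lemma redL_neq0 x : redL x != 0 -> w (val x) = 0%E.
Proof.
move/eqP => x0; have x_ge : (0 <= w (val x))%E := valP x.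
apply/le_anti; rewrite x_ge andbT leNgt; apply/negP => x_gt.
exact/x0/redL_eq0.
Qed.

Lemma redL_surj y : exists2 a : val_ring_of vK, red a = y
  & forall x : val_ring_of w, val x = (val a)%:A -> redL x = y.
Proof.
have [a <-] := red_residue.1 y; exists a => // x xa.
by apply: redL_uniq; rewrite xa subrr valuation0 ltey.
Qed.


(** * Completeness of L and Hensel's lemma *)

Section Completeness.
Hypothesis vK_complete : val_complete vK.

Lemma inL_sub (g h : {poly K}) x : (inL g).[x] - (inL h).[x] = (inL (g - h)).[x].
Proof. by rewrite rmorphB hornerD hornerN. Qed.

Lemma size_sub_le (g h : {poly K}) n :
  (size g <= n)%N -> (size h <= n)%N -> (size (g - h)%R <= n)%N.
Proof.
move=> sg sh; apply: leq_trans (size_polyD _ _) _.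
by rewrite size_polyN geq_max sg.
Qed.

Lemma L_complete : val_complete w.
Proof.
move=> u cu.
have [h hP] := choice (fun n => let: ex_intro2 p a b := pi_span (u n) in
  ex_intro (fun p : {poly K} => (size p <= e)%N /\ u n = (inL p).[piL]) p (conj a b)).
have hs n := (hP n).1; have hu n := (hP n).2.
have cauchy_coef (l : 'I_e) : val_cauchy vK (fun n => (h n)`_l).
  (* The extra 1 pays for l/e < 1 in passing from a term of the expansion to its coefficient. *)
  move=> N; have [n0 n0P] := cu (N + 1); exists n0 => m n mn nn.
  have := n0P _ _ mn nn; rewrite !hu inL_sub.
  move=> /(w_coef_ge (size_sub_le (hs m) (hs n)))/(_ l (ltn_ord l)); rewrite coefB.
  have [->|d0] := eqVneq ((h m)`_l - (h n)`_l) 0; first by move=> _;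
    rewrite valuation0 leey.
  have l1 : l%:R / e%:R <= 1 :> R.
    by rewrite ler_pdivrMr ?dimR_gt0 // mul1r ler_nat ltnW.
  by rewrite (val_fin vK d0) -EFinD !lee_fin; move: l1; set t := _ / _; lra.
have [b bP] := choice (fun l : 'I_e => vK_complete (cauchy_coef l)).
pose H := \poly_(l < e) (if insub l is Some l' then b l' else 0).
have Hb (l : 'I_e) : H`_l = b l by rewrite coef_poly ltn_ord valK.
exists (inL H).[piL] => N.
have [n_ n_P] := choice (fun l => bP l N).
exists (\max_l n_ l)%N => n nn; rewrite hu inL_sub.
rewrite (horner_coef_wide _ (n := e)) ?size_map_poly ?size_sub_le ?size_poly //.
apply: val_sum_ge => l _; rewrite coef_map valuationM w_ext coefB Hb w_piX.
apply: le_trans (n_P l n _) _; first exact: leq_trans (leq_bigmax _) nn.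
by rewrite leeDl // lee_fin divr_ge0 // ler0n.
Qed.

Notation O := (val_ring_of w).

Lemma O_ge0 (x : O) : (0 <= w (val x))%E. Proof. exact: (valP x). Qed.

Lemma horner_taylor2 (A : comNzRingType) (G : {poly A}) (x h : A) :
  exists c, G.[x + h] = G.[x] + G^`().[x] * h + c * h ^+ 2.
Proof.
elim/poly_ind: G => [|G a [c IH]].
  by exists 0; rewrite deriv0 !horner0; ring.
exists (c * (x + h) + G^`().[x]).
rewrite derivD derivC addr0 derivM derivX mulr1 !(hornerMXaddC, hornerD, hornerMX) IH; ring.
Qed.

Lemma horner_taylor1 (A : comNzRingType) (G : {poly A}) (x h : A) :
  exists c, G.[x + h] = G.[x] + c * h.
Proof.
by have [c ->] := horner_taylor2 G x h; exists (G^`().[x] + c * h); ring.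
Qed.

Lemma w_mul_ge (x y : O) a : (a <= w (val y))%E -> (a <= w (val (x * y)%R))%E.
Proof.
move=> ay; rewrite rmorphM valuationM; apply: le_trans ay _.
by rewrite leeDr // O_ge0.
Qed.

Lemma val_eq0 x : (forall N : R, (N%:E <= w x)%E) -> x = 0.
Proof.
move=> wx; apply: contrapT => /eqP x0; have := wx (fine (w x) + 1).
by rewrite {2}(val_fin w x0) lee_fin; lra.
Qed.

(** Newton iteration with the derivative frozen at [x0]. It converges only linearly, but values are
    discrete, so that each step gains at least 1/e. *)
Lemma hensel (G : {poly O}) (x0 : O) :
  (0 < w (val G.[x0]))%E -> w (val G^`().[x0]) = 0%E -> exists x : O, G.[x] = 0.
Proof.
move=> G0 G'0.
have d0 : val G^`().[x0] != 0 by apply: val_neq0 G'0.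
have ui0 : (val G^`().[x0])^-1 \in val_ring w.
  by rewrite inE (valV_fin G'0) oppr0.
pose ui : O := ValRing ui0.
have ui1 : ui * G^`().[x0] = 1 by apply: val_inj; rewrite /= mulVf.
pose x_ n := iter n (fun x => x - ui * G.[x]) x0.
have xS n : x_ n.+1 = x_ n - ui * G.[x_ n] by [].
have step n : ((n.+1%:R / e%:R)%:E <= w (val G.[x_ n]))%E /\ (0 < w (val (x_ n - x0)%R))%E.
  elim: n => [|n [IHG IHx]].
    by rewrite mul1r w_gt0 //= subrr valuation0 ltey.
  have t0 : (0 < (n.+1%:R / e%:R)%:E :> \bar R)%E.
    by rewrite lte_fin divr_gt0 ?ltr0n ?dimL_gt0.
  split; last first.
    have -> : x_ n.+1 - x0 = (x_ n - x0) - ui * G.[x_ n] by rewrite xS; ring.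
    rewrite rmorphB; apply: lt_le_trans (valB _ _ _); rewrite lt_min.
    by apply/andP; split=> //; apply: lt_le_trans t0 _; exact: w_mul_ge.
  have [c Dc] := horner_taylor2 G (x_ n) (- (ui * G.[x_ n])).
  have [c' Dc'] := horner_taylor1 G^`() x0 (x_ n - x0).
  rewrite addrC subrK in Dc'.
  (* The bracket has positive value: [ui] inverts the derivative at [x0], and the derivative at
     [x_ n] differs from it by a multiple of [x_ n - x0]. *)
  have -> : G.[x_ n.+1] = (- (ui * c') * (x_ n - x0) + c * ui ^+ 2 * G.[x_ n]) * G.[x_ n].
    rewrite xS Dc Dc'.
    transitivity ((1 - ui * G^`().[x0]) * G.[x_ n]
      + (- (ui * c') * (x_ n - x0) + c * ui ^+ 2 * G.[x_ n]) * G.[x_ n]); first by ring.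
    by rewrite ui1 subrr mul0r add0r.
  rewrite rmorphM valuationM.
  have -> : (n.+2%:R / e%:R)%:E = ((e%:R^-1)%:E + (n.+1%:R / e%:R)%:E :> \bar R)%E.
    by rewrite -EFinD -[n.+2]add1n natrD mulrDl mul1r.
  apply: leeD => //; apply: w_gt0; rewrite rmorphD; apply: lt_le_trans (valuationD _ _ _).
  rewrite lt_min; apply/andP; split.
    by apply: lt_le_trans (w_mul_ge _ (lexx _)).
  by apply: lt_le_trans (w_mul_ge _ (lexx _)); apply: lt_le_trans IHG.
have dist m n : (n <= m)%N -> ((n.+1%:R / e%:R)%:E <= w (val (x_ m - x_ n)%R))%E.
  elim: m => [|m IH]; first by rewrite leqn0 => /eqP ->; rewrite subrr valuation0 leey.
  rewrite leq_eqVlt => /predU1P[->|]; first by rewrite subrr valuation0 leey.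
  rewrite ltnS => nm; have -> : x_ m.+1 - x_ n = (x_ m - x_ n) - ui * G.[x_ m].
    by rewrite xS; ring.
  rewrite rmorphB; apply: le_trans (valB _ _ _); rewrite le_min.
  apply/andP; split; first exact: IH.
  apply: w_mul_ge; apply: le_trans (step m).1.
  by rewrite lee_fin ler_wpM2r ?invr_ge0 ?ler0n // ler_nat.
have big (N : R) : exists n, N <= n.+1%:R / e%:R.
  exists (Num.bound `|N * e%:R|); rewrite ler_pdivlMr ?dimR_gt0 //.
  apply: le_trans (ler_norm _) _; apply: ltW.
  by apply: lt_trans (archi_boundP (normr_ge0 _)) _; rewrite ?ltr_nat.
have [|y yP] := L_complete (u := fun n => val (x_ n)).
  move=> N; have [n0 n0P] := big N; exists n0 => m n mn nn.
  have -> : val (x_ m) - val (x_ n) = val (x_ m - x_ n0) - val (x_ n - x_ n0).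
    by rewrite !rmorphB /=; ring.
  apply: le_trans (valB _ _ _); rewrite le_min.
  by rewrite !(le_trans _ (dist _ _ _)) // lee_fin.
have y_ge0 : y \in val_ring w.
  have [n0 n0P] := yP 0; rewrite inE -[y](subKr (val (x_ n0))).
  by apply: le_trans (valB _ _ _); rewrite le_min O_ge0 n0P.
exists (ValRing y_ge0); apply: val_inj; rewrite -[RHS]/(0 : L); apply: val_eq0 => N.
have [n0 n0P] := yP N; have [n1 n1P] := big N.
pose n := maxn n0 n1.
have [c Dc] := horner_taylor1 G (x_ n) (ValRing y_ge0 - x_ n).
rewrite addrC subrK in Dc; rewrite Dc rmorphD.
apply: le_trans (valuationD _ _ _); rewrite le_min; apply/andP; split.
  apply: le_trans (step n).1; rewrite lee_fin (le_trans n1P) //.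
  by rewrite ler_wpM2r ?invr_ge0 ?ler0n // ler_nat ltnS leq_maxr.
apply: w_mul_ge; rewrite rmorphB -valuationN opprB; apply: n0P; exact: leq_maxl.
Qed.


(** * The last break and its affine action on residues *)

Section Ramification.
Hypothesis L_galois : galois 1%AS {:L}%AS.
Hypothesis L_neqK : {:L}%VS != 1%VS.
Notation G := ('Gal({:L} / 1))%g.

Lemma card_gal : #|G| = e.
Proof. by rewrite -(galois_dim L_galois) dimv1 divn1. Qed.

Lemma gal_inj (s t : gal_of {:L}) : s piL = t piL -> s = t.
Proof.
move=> st; apply/eqP/gal_eqP => x _; have [h _ ->] := pi_span x.
by rewrite !gal_inL st.
Qed.

Lemma gal_mulE (s t : gal_of {:L}) x : (s * t)%g x = t (s x).
Proof. by rewrite galM ?memvf. Qed.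

Lemma f_conj_prod : inL f = \prod_(s in G) ('X - (s piL)%:P).
Proof.
have rf (s : gal_of {:L}) : root (inL f) (s piL).
  by rewrite /root -gal_inL f_min (rootP (root_minPoly _ _)) rmorph0.
have [mf sf _ _] := f_eis.
rewrite [LHS](@all_roots_prod_XsubC _ _ [seq s piL | s : gal_of {:L} in G]).
- have mLf : inL f \is monic by rewrite map_monic.
  by rewrite (monicP mLf) scale1r big_image.
- by rewrite size_map_poly sf size_image card_gal.
- by apply/allP => x /mapP [s _ ->].
by rewrite uniq_rootsE map_inj_uniq ?enum_uniq //; exact: gal_inj.
Qed.

Definition lower_indexR (s : gal_of {:L}) : R := fine (w (s piL - piL)).

Lemma gal_pi_neq (s : gal_of {:L}) : s != 1%g -> s piL - piL != 0.
Proof.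
apply: contraNneq => /eqP; rewrite subr_eq0 => /eqP spi; apply/eqP/gal_inj.
by rewrite gal_id.
Qed.

Lemma lower_indexRE (s : gal_of {:L}) : s != 1%g -> w (s piL - piL) = (lower_indexR s)%:E.
Proof. by move=> s1; apply: val_fin; exact: gal_pi_neq. Qed.

Lemma lower_indexR_ge (s : gal_of {:L}) : s != 1%g -> e%:R^-1 <= lower_indexR s.
Proof.
move=> s1; rewrite -lee_fin -lower_indexRE //; apply: le_trans (valB _ _ _).
by rewrite w_gal w_pi le_min lexx.
Qed.

Lemma lower_indexR_gt0 (s : gal_of {:L}) : s != 1%g -> 0 < lower_indexR s.
Proof. by move=> /lower_indexR_ge; apply: lt_le_trans; rewrite invr_gt0 dimR_gt0. Qed.

Lemma w_coef_ge0 (h : {poly K}) : (size h <= e)%N -> (0 <= w (inL h).[piL])%E ->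
  forall l, (l < e)%N -> (0 <= vK h`_l)%E.
Proof.
move=> sh /(w_coef_ge sh) ge l le; apply: (vK_gtN1 vK_discrete).
have := ge l le; have [->|hl0] := eqVneq h`_l 0; first by rewrite valuation0 ltey.
have : l%:R / e%:R < 1 :> R by rewrite ltr_pdivrMr ?dimR_gt0 // mul1r ltr_nat.
rewrite (val_fin vK hl0) -EFinD lee_fin lte_fin; set t := _ / _; lra.
Qed.

(** Each (s piL)^l - piL^l is divisible by s piL - piL, and an integral element has integral
    coefficients. So the infimum defining i(s) is reached at [piL]. *)
Lemma gal_sub_ge (s : gal_of {:L}) x : (0 <= w x)%E ->
  (w (s piL - piL)%R <= w (s x - x)%R)%E.
Proof.
have [h sh ->] := pi_span x => /(w_coef_ge0 sh) h0.
rewrite gal_inL !(horner_coef_wide _ (n := e)) ?size_map_poly // -sumrB.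
apply: val_sum_ge => l _; rewrite -mulrBr coef_map subrXX mulrCA valuationM.
rewrite leeDl // valuationM adde_ge0 //; first by rewrite w_ext h0.
apply: val_sum_ge => i _.
have wspi : w (s piL) = (e%:R^-1)%:E by rewrite w_gal w_pi.
rewrite (valM_fin (valX_fin _ wspi) (valX_fin _ w_pi)) lee_fin.
by rewrite addr_ge0 // mulrn_wge0 // invr_ge0 ler0n.
Qed.

Lemma w_piL_ge0 : (0 <= w piL)%E.
Proof. by rewrite w_pi lee_fin invr_ge0 ler0n. Qed.

Lemma lower_indexE (s : gal_of {:L}) : lower_index w s = w (s piL - piL).
Proof.
apply/le_anti/andP; split.
  by apply: ereal_inf_lbound; exists piL => //=; rewrite inE; exact: w_piL_ge0.
by apply: le_ereal_inf_tmp => _ [a a0 <-]; exact: gal_sub_ge.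
Qed.

Lemma lower_index1 : lower_index w 1%g = +oo%E.
Proof. by rewrite lower_indexE gal_id subrr valuation0. Qed.

Lemma lower_index_fin (s : gal_of {:L}) : s != 1%g -> lower_index w s = (lower_indexR s)%:E.
Proof. by move=> s1; rewrite lower_indexE lower_indexRE. Qed.

Lemma lower_index_ge0 (s : gal_of {:L}) : (0 <= lower_index w s)%E.
Proof.
have [->|s1] := eqVneq s 1%g; first by rewrite lower_index1 leey.
by rewrite lower_index_fin // lee_fin ltW // lower_indexR_gt0.
Qed.

Lemma max_break : exists s0 : gal_of {:L}, s0 != 1%g /\ forall s, s != 1%g ->
  lower_indexR s <= lower_indexR s0.
Proof.
have [s1 s1P] : exists s1 : gal_of {:L}, s1 != 1%g.
  apply: contrapT => no; move: L_neqK; apply/negP/negPn.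
  have G1 : #|G| = 1%N.
    apply/eqP; rewrite -trivg_card1; apply/eqP/trivgP/fintype.subsetP => s _.
    by rewrite inE; apply: contrapT => /negP s1; apply: no; exists s.
  by rewrite eq_sym eqEdim sub1v dimv1 -card_gal G1.
have [s0 s0P max0] := @arg_maxP _ _ _ s1 (fun s => s != 1%g) lower_indexR s1P.
by exists s0; split=> // s; exact: max0.
Qed.

Definition max_gal := projT1 (cid max_break).
Definition max_lower := lower_indexR max_gal.
(* The value at [max_lower] of the Herbrand function i |-> sum_s min(i, i(s)). *)
Definition max_upper := max_lower + \sum_(s | s != 1%g) lower_indexR s.

Lemma max_gal_neq1 : max_gal != 1%g. Proof. exact: (projT2 (cid max_break)).1. Qed.
Lemma lower_indexR_le (s : gal_of {:L}) : s != 1%g -> lower_indexR s <= max_lower.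
Proof. exact: (projT2 (cid max_break)).2. Qed.

Lemma max_lower_gt0 : 0 < max_lower. Proof. exact: lower_indexR_gt0 max_gal_neq1. Qed.

Lemma lower_breakE : lower_break w = max_lower.
Proof.
apply: inf_gt => i; split=> [[i_ge0 Gi]|i_gt].
  rewrite ltNge; apply/negP => le_i0.
  have : max_gal \in lower_group w i.
    by rewrite inE mem_gal1 lower_index_fin ?max_gal_neq1 // lee_fin.
  by rewrite Gi inE (negPf max_gal_neq1).
split; first by rewrite ltW // (lt_trans max_lower_gt0).
apply/setP => s; rewrite !inE mem_gal1 /=; have [->|s1] := eqVneq s 1%g.
  by rewrite lower_index1 leey.
by rewrite lower_index_fin // lee_fin leNgt (le_lt_trans (lower_indexR_le s1)).
Qed.

Lemma ram_phi_fin i : 0 <= i ->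
  ram_phi w i%:E = (i + \sum_(s | s != 1%g) Num.min i (lower_indexR s))%:E.
Proof.
move=> i_ge0; rewrite ram_phiE ?lee_fin //; last exact: lower_index_ge0.
rewrite (bigD1 1%g) ?mem_gal1 //= lower_index1 min_l ?leey // EFinD; congr (_ + _)%E.
rewrite -sumEFin; apply: eq_big => [s|s /andP [_ s1]]; first by rewrite mem_gal1.
by rewrite lower_index_fin // EFin_min.
Qed.

Lemma ram_phi_y : ram_phi w +oo%E = +oo%E.
Proof.
rewrite ram_phiE ?leey //; last exact: lower_index_ge0.
rewrite (bigD1 1%g) ?mem_gal1 //= lower_index1 min_l // addye //.
rewrite -ltNye; apply: lt_le_trans (sume_ge0 _ _) => // s _.
by rewrite le_min leey lower_index_ge0.
Qed.

Lemma upper_breakE : upper_break w = max_upper.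
Proof.
have ui_le s : s != 1%g -> (upper_index w s <= max_upper%:E)%E.
  move=> s1; rewrite /upper_index lower_index_fin // ram_phi_fin;
    last exact: ltW (lower_indexR_gt0 s1).
  rewrite lee_fin; apply: lerD (lower_indexR_le s1) _; apply: ler_sum => t _.
  by rewrite ge_min lexx orbT.
have ui_max : upper_index w max_gal = max_upper%:E.
  rewrite /upper_index lower_index_fin ?max_gal_neq1 // ram_phi_fin;
    last exact: ltW max_lower_gt0.
  congr (_ + _)%:E; apply: eq_bigr => s s1; rewrite min_r //; exact: lower_indexR_le.
have u0_ge0 : 0 <= max_upper.
  by apply: addr_ge0; [exact: ltW max_lower_gt0 | apply: sumr_ge0 => s
    /lower_indexR_gt0/ltW].
apply: inf_gt => u; split=> [[u_ge0 Gu]|u_gt].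
  rewrite ltNge; apply/negP => le_u0.
  have : max_gal \in upper_group w u by rewrite inE mem_gal1 ui_max lee_fin.
  by rewrite Gu inE (negPf max_gal_neq1).
split; first by rewrite ltW // (le_lt_trans u0_ge0).
apply/setP => s; rewrite !inE mem_gal1 /=; have [->|s1] := eqVneq s 1%g.
  by rewrite /upper_index lower_index1 ram_phi_y leey.
apply/negbTE; rewrite -ltNge; apply: le_lt_trans (ui_le _ s1) _.
by rewrite lte_fin.
Qed.

(** The default 0 outside the valuation ring makes [resid] total on L; its algebraic rules therefore
    carry integrality hypotheses. *)
Definition to_O (x : L) : O := insubd (0 : O) x.

Lemma to_OK x : (0 <= w x)%E -> val (to_O x) = x.
Proof. by move=> x0; rewrite val_insubd inE x0. Qed.

Definition resid x : k := redL (to_O x).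

Lemma resid_val (x : O) : resid (val x) = redL x.
Proof. by congr (redL _); apply: val_inj; rewrite to_OK ?O_ge0. Qed.

Lemma residD x y : (0 <= w x)%E -> (0 <= w y)%E -> resid (x + y) = resid x + resid y.
Proof.
move=> x0 y0; rewrite -(to_OK x0) -(to_OK y0) -rmorphD !resid_val.
exact: (rmorphD redL).
Qed.

Lemma residM x y : (0 <= w x)%E -> (0 <= w y)%E -> resid (x * y) = resid x * resid y.
Proof.
move=> x0 y0; rewrite -(to_OK x0) -(to_OK y0) -rmorphM !resid_val.
exact: (rmorphM redL).
Qed.

Lemma residX x n : (0 <= w x)%E -> resid (x ^+ n) = resid x ^+ n.
Proof.
move=> x0; rewrite -(to_OK x0) -rmorphXn !resid_val.
exact: (rmorphXn redL).
Qed.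

Lemma resid1 : resid 1 = 1.
Proof. by rewrite -[1 in LHS]/(val (1 : O)) resid_val; exact: (rmorph1 redL). Qed.

Lemma resid_eq0 x : (0 <= w x)%E -> resid x = 0 <-> (0 < w x)%E.
Proof. by move=> x0; rewrite -{2}(to_OK x0); exact: redL_eq0. Qed.

Lemma resid_neq0 x : w x = 0%E -> resid x != 0.
Proof.
move=> x0; apply/eqP => /resid_eq0; rewrite x0 ltxx => /(_ (lexx _)).
by [].
Qed.

Lemma residB x y : (0 <= w x)%E -> (0 <= w y)%E -> resid (x - y) = resid x - resid y.
Proof.
move=> x0 y0; rewrite -(to_OK x0) -(to_OK y0) -rmorphB !resid_val.
exact: (rmorphB redL).
Qed.

(** Up to an element of positive value [x] lies in K, which [s] fixes. *)
Lemma resid_gal (s : gal_of {:L}) x : (0 <= w x)%E -> resid (s x) = resid x.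
Proof.
move=> x0; have sx0 : (0 <= w (s x))%E by rewrite w_gal.
have [a ax] : exists a : val_ring_of vK, (0 < w (x - (val a)%:A)%R)%E.
  by have [a] := residue_lift_ex (to_O x); rewrite to_OK //; exists a.
rewrite /resid (redL_uniq (a := a)) ?to_OK //.
  by rewrite (redL_uniq (a := a)) ?to_OK.
have -> : s x - (val a)%:A = s (x - (val a)%:A).
  by rewrite rmorphB /= gal_alg.
by rewrite w_gal.
Qed.

Lemma max_lower_frac : exists n : nat, max_lower = n.+1%:R / e%:R.
Proof.
have [m] := w_int (gal_pi_neq max_gal_neq1); rewrite lower_indexRE ?max_gal_neq1 // => -[].
rewrite -/max_lower => im; have := max_lower_gt0;
  rewrite im pmulr_lgt0 ?invr_gt0 ?dimR_gt0 //.
by rewrite ltr0z; case: m im => // -[|n] // im _; exists n.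
Qed.

(* The extension is tame if and only if [break_exp] = 0. *)
Definition break_exp := projT1 (cid max_lower_frac).
Lemma max_lowerE : max_lower = break_exp.+1%:R / e%:R.
Proof. exact: (projT2 (cid max_lower_frac)). Qed.

Definition break_elt := piL ^+ break_exp.+1.

Lemma w_break_elt : w break_elt = max_lower%:E.
Proof. by rewrite /break_elt w_piX max_lowerE. Qed.

Lemma break_elt_neq0 : break_elt != 0. Proof. exact: val_neq0 w_break_elt. Qed.

Lemma lower_group_set i : group_set (lower_group w i).
Proof.
apply/group_setP; split=> [|s t]; first by rewrite inE mem_gal1 lower_index1 leey.
rewrite !inE !mem_gal1 /= !lower_indexE => si ti.
have -> : (s * t)%g piL - piL = t (s piL - piL) + (t piL - piL).
  by rewrite gal_mulE rmorphB /=; ring.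
by apply: le_trans (valuationD _ _ _); rewrite le_min w_gal si.
Qed.
Definition lower_group_group i := Group (lower_group_set i).

Notation H := (lower_group_group max_lower).

Lemma in_H (s : gal_of {:L}) : (s \in H) = (max_lower%:E <= w (s piL - piL)%R)%E.
Proof. by rewrite inE mem_gal1 lower_indexE. Qed.

Lemma H_lower_indexR s : s \in H -> s != 1%g -> lower_indexR s = max_lower.
Proof.
rewrite in_H => si s1; apply/le_anti; rewrite lower_indexR_le //=.
by rewrite lower_indexRE in si.
Qed.

Lemma notH_neq1 s : s \notin H -> s != 1%g.
Proof. by apply: contraNneq => ->; exact: group1. Qed.

Lemma notH_lower_indexR s : s \notin H -> lower_indexR s < max_lower.
Proof. by move=> sH; move: (sH);
  rewrite in_H lower_indexRE ?notH_neq1 // -ltNge lte_fin. Qed.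

Lemma max_gal_H : max_gal \in H.
Proof. by rewrite in_H lower_indexRE ?max_gal_neq1. Qed.

Definition theta (s : gal_of {:L}) := resid ((s piL - piL) / break_elt).
Definition psi (s : gal_of {:L}) := resid (s break_elt / break_elt).

Lemma theta_arg_ge0 s : s \in H -> (0 <= w ((s piL - piL) / break_elt)%R)%E.
Proof. by rewrite in_H => si; apply: (val_div_ge w_break_elt); rewrite addr0. Qed.

Lemma psi_arg (s : gal_of {:L}) : w (s break_elt / break_elt) = 0%E.
Proof.
have sc : w (s break_elt) = max_lower%:E by rewrite w_gal w_break_elt.
by rewrite (val_div_fin sc w_break_elt) subrr.
Qed.

Lemma gal_unit_pi (s : gal_of {:L}) : w (s piL / piL) = 0%E.
Proof.
have sc : w (s piL) = (e%:R^-1)%:E by rewrite w_gal w_pi.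
by rewrite (val_div_fin sc w_pi) subrr.
Qed.

Lemma piL_neq0 : piL != 0. Proof. exact: val_neq0 w_pi. Qed.

Lemma psiE s : psi s = resid (s piL / piL) ^+ break_exp.+1.
Proof.
by rewrite -residX ?gal_unit_pi // expr_div_n /psi /break_elt rmorphXn.
Qed.

(** The last break then exceeds 1/e, so that s piL / piL is congruent to 1. *)
Lemma psi_wild s : (0 < break_exp)%N -> s \in H -> psi s = 1.
Proof.
move=> exp_gt0 sH; rewrite psiE.
suff -> : resid (s piL / piL) = 1 by rewrite expr1n.
apply/eqP; rewrite -subr_eq0 -resid1 -residB ?gal_unit_pi ?valuation1 //; apply/eqP.
have gt : (0 < w (s piL / piL - 1)%R)%E.
  have -> : s piL / piL - 1 = (s piL - piL) / piL by rewrite mulrBl mulfV ?piL_neq0.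
  apply: (val_div_gt w_pi); rewrite addr0; move: sH; rewrite in_H; apply: lt_le_trans.
  by rewrite lte_fin max_lowerE ltr_pMl ?invr_gt0 ?dimR_gt0 // ltr1n.
by apply/resid_eq0 => //; exact: ltW.
Qed.

Lemma theta_tame s : break_exp = 0%N -> theta s = psi s - 1.
Proof.
move=> exp0; rewrite -resid1 -residB ?psi_arg ?valuation1 //; congr resid.
by rewrite /break_elt exp0 expr1 mulrBl mulfV ?piL_neq0.
Qed.

(** The law for theta reduces (s t) piL - piL = t (s piL - piL) + (t piL - piL), as t acts trivially
    on residues. It is faithful because on nontrivial elements of H the value of s piL - piL is
    exactly [max_lower]. *)
Lemma theta_psi_affine : affine_action H theta psi.
Proof.
split.
- by rewrite /psi gal_id mulfV ?break_elt_neq0 // resid1.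
- move=> s t sH tH; rewrite /psi.
  have -> : (s * t)%g break_elt / break_elt = t (s break_elt / break_elt) * (t break_elt
    / break_elt).
    rewrite gal_mulE fmorph_div /= mulrA divfK // fmorph_eq0; exact: break_elt_neq0.
  by rewrite residM ?resid_gal ?w_gal ?psi_arg.
- move=> s t sH tH; rewrite /theta /psi.
  have -> : ((s * t)%g piL - piL) / break_elt
     = (t piL - piL) / break_elt + (t break_elt / break_elt) * t ((s piL - piL) /
       break_elt).
    have tc : t break_elt != 0 by rewrite fmorph_eq0 break_elt_neq0.
    rewrite gal_mulE fmorph_div rmorphB /=; field.
    by rewrite tc break_elt_neq0.
  have sg := theta_arg_ge0 sH; have tg := theta_arg_ge0 tH.
  have pg : (0 <= w (t break_elt / break_elt)%R)%E by rewrite psi_arg.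
  have tsg : (0 <= w (t ((s piL - piL) / break_elt)%R))%E by rewrite w_gal.
  rewrite residD //; last by rewrite valuationM adde_ge0.
  by rewrite (residM pg tsg) resid_gal.
- move=> s sH /(resid_eq0 (theta_arg_ge0 sH)) s_gt; apply/eqP/negPn/negP => s1.
  by move: s_gt; rewrite (val_div_fin (lower_indexRE s1) w_break_elt) H_lower_indexR //
    subrr ltxx.
case: (posnP break_exp) => [exp0|exp_gt0]; [right|left] => s sH; first exact: theta_tame.
exact: psi_wild.
Qed.

(** This rules out the first alternative of [aff_nondeg] in the tame case, so that nondegeneracy
    really says that -1 is not a root. *)
Lemma H_psi_neq1 : break_exp = 0%N -> exists2 s, s \in H & psi s != 1.
Proof.
move=> exp0; exists max_gal; first exact: max_gal_H.
apply/eqP => p1; have := affine_inj theta_psi_affine max_gal_H.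
by rewrite theta_tame // p1 subrr => /(_ erefl) s1; have := max_gal_neq1; rewrite s1 eqxx.
Qed.

(** * Reduction of the polynomials close to f *)

(** In f(piL + break_elt X), the product of the piL - s piL + break_elt X, a factor with s in H is
    divided by [break_elt]; any other is dominated by its constant term piL - s piL and reduces to 1
    after division by it. *)
Definition far_prod := \prod_(s | s \notin H) (piL - s piL).
Definition red_scale := break_elt ^+ #|H| * far_prod.

Lemma w_red_scale : w red_scale = max_upper%:E.
Proof.
have wD : w far_prod = (\sum_(s | s \notin H) lower_indexR s)%:E.
  by apply: val_prod_fin => s sH; rewrite -valuationN opprB lower_indexRE ?notH_neq1.
rewrite (valM_fin (valX_fin _ w_break_elt) wD); congr (_%:E).
rewrite /max_upper [in RHS](bigID (mem H)) /= addrA; congr (_ + _); last first.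
  apply: eq_bigl => s; case: (boolP (s \in H)) => sH; rewrite ?andbF ?andbT //.
  by rewrite notH_neq1.
(* The index s = 1 of H supplies the leading summand [max_lower] of [max_upper]. *)
rewrite -sumr_const (bigD1 1%g) ?(group1 H) //=; congr (_ + _).
apply: eq_big => [s|s /andP [sH s1]]; first by rewrite andbC.
by rewrite H_lower_indexR.
Qed.

Lemma red_scale_neq0 : red_scale != 0. Proof. exact: val_neq0 w_red_scale. Qed.


Lemma w_gal_sub (s : gal_of {:L}) : s \notin H -> w (piL - s piL) = (lower_indexR s)%:E.
Proof. by move=> sH; rewrite -valuationN opprB lower_indexRE ?notH_neq1. Qed.

Lemma break_elt_div_gt0 s : s \notin H -> (0 < w (break_elt / (piL - s piL))%R)%E.
Proof.
by move=> sH; rewrite (val_div_fin w_break_elt (w_gal_sub sH)) lte_fin subr_gt0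
  notH_lower_indexR.
Qed.

Lemma w_break_elt_pi : w (break_elt / piL) = (break_exp%:R / e%:R)%:E.
Proof. by rewrite /break_elt exprSr mulfK ?piL_neq0 // w_piX. Qed.

Lemma break_elt_pi_ge0 : (0 <= w (break_elt / piL)%R)%E.
Proof. by rewrite w_break_elt_pi lee_fin divr_ge0 ?ler0n. Qed.

Lemma vr_valB (x y : O) : vr_val (x - y) = vr_val x - vr_val y. Proof. by []. Qed.
Lemma vr_valD (x y : O) : vr_val (x + y) = vr_val x + vr_val y. Proof. by []. Qed.
Lemma vr_valM (x y : O) : vr_val (x * y) = vr_val x * vr_val y. Proof. by []. Qed.
Lemma vr_val1 : vr_val (1 : O) = 1. Proof. by []. Qed.
Lemma vr_valX (x : O) n : vr_val (x ^+ n) = vr_val x ^+ n.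
Proof. exact: (rmorphXn (val : O -> L)). Qed.
Lemma vr_to_O x : (0 <= w x)%E -> vr_val (to_O x) = x. Proof. exact: to_OK. Qed.

(* For g close to f, the polynomial g(piL + break_elt * X) / red_scale is integral
   and reduces to [aff_poly + pert_resid]: [f_scaled] and [pert_scaled] are the
   contributions of f and of g - f to it. *)
Definition f_scaled : {poly O} :=
  \prod_(s in H) ('X - (to_O ((s piL - piL) / break_elt))%:P)
  * \prod_(s | s \notin H) (1 + (to_O (break_elt / (piL - s piL)))%:P * 'X).

Lemma f_scaled_eval (x : O) : val f_scaled.[x] * red_scale = (inL f).[piL + break_elt *
  val x].
Proof.
rewrite f_conj_prod horner_prod (eq_bigl xpredT) => [|s]; last exact: mem_gal1.
rewrite (bigID (mem H)) /= /f_scaled -[vr_val _]/(val _) hornerM rmorphM !horner_prod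
  !rmorph_prod /red_scale mulrACA.
congr (_ * _).
  rewrite -prodr_const -big_split; apply: eq_bigr => s sH.
  rewrite /= !hornerXsubC vr_valB (vr_to_O (theta_arg_ge0 sH)).
  by rewrite mulrBl divfK ?break_elt_neq0 // mulrC; ring.
rewrite -big_split; apply: eq_bigr => s sH.
rewrite /= !hornerE vr_valD vr_valM vr_val1 (vr_to_O (ltW (break_elt_div_gt0 sH))).
have d0 := val_neq0 (w_gal_sub sH).
by rewrite mulrDl mul1r mulrAC divfK //; ring.
Qed.

Lemma f_scaled_red : map_poly redL f_scaled = aff_poly H theta.
Proof.
rewrite rmorphM !rmorph_prod /= [X in _ * X]big1 ?mulr1.
  by apply: eq_bigr => s sH; rewrite map_polyXsubC.
move=> s sH; rewrite rmorphD rmorphM rmorph1 /= map_polyC map_polyX /=.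
have /redL_eq0 -> : (0 < w (val (to_O (break_elt / (piL - s piL)))))%E.
  by rewrite to_OK ?ltW ?break_elt_div_gt0.
by rewrite mul0r addr0.
Qed.

(** Being Eisenstein is left out of this condition, because in the tame case the reduction of a
    perturbed g is what decides whether g is Eisenstein. *)
Definition close_to_f (g : {poly K}) := (size (g - f)%R <= e)%N /\
  forall l, (l < e)%N -> (max_upper%:E <= vK ((g - f)`_l)%R + (l%:R / e%:R)%:E)%E.

Lemma sum_invr_e : \sum_(s : gal_of {:L}) (e%:R^-1 : R) = 1.
Proof.
rewrite sumr_const (_ : #|_| = e); first by rewrite -[LHS]mulr_natr mulVf ?gt_eqF ?dimR_gt0.
by rewrite -card_gal; apply: eq_card => s; rewrite mem_gal1.
Qed.

Lemma max_upper_ge : 1 + break_exp%:R / e%:R <= max_upper.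
Proof.
rewrite -[X in X + _]sum_invr_e (bigD1 1%g) //= addrAC; apply: lerD.
  by rewrite max_lowerE -[break_exp.+1]add1n natrD mulrDl mul1r.
by apply: ler_sum => s; exact: lower_indexR_ge.
Qed.

(** All indices i(s), s != 1, are squeezed between 1/e and [max_lower], which is 1/e here. *)
Lemma max_upper_tame : break_exp = 0%N -> max_upper = 1.
Proof.
move=> exp0; have i0e : max_lower = e%:R^-1 by rewrite max_lowerE exp0 mul1r.
rewrite /max_upper (eq_bigr (fun=> e%:R^-1)) => [|s s1]; last first.
  by apply/le_anti; rewrite lower_indexR_ge // andbT -i0e lower_indexR_le.
by rewrite i0e -[RHS]sum_invr_e [in RHS](bigD1 1%g).
Qed.

Section Perturbation.
Variables (g : {poly K}) (fg : close_to_f g).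

Definition pert_coef l : L := ((g - f)`_l)%:A * piL ^+ l / red_scale.

Lemma pert_coef_ge0 l : (l < e)%N -> (0 <= w (pert_coef l))%E.
Proof.
move=> le; apply: (val_div_ge w_red_scale); rewrite addr0 valuationM w_ext w_piX.
exact: fg.2.
Qed.

Definition pert_scaled : {poly O} :=
  \sum_(l < e) (to_O (pert_coef l))%:P * (1 + (to_O (break_elt / piL))%:P * 'X) ^+ l.

Lemma pert_scaled_eval (x : O) : val pert_scaled.[x] * red_scale = (inL (g - f)).[piL +
  break_elt * val x].
Proof.
rewrite [in RHS](horner_coef_wide _ (n := e)) ?size_map_poly ?fg.1 //.
rewrite /pert_scaled horner_sum rmorph_sum mulr_suml; apply: eq_bigr => l _.
rewrite /= hornerM horner_exp hornerD hornerMX !hornerC vr_valM vr_valX vr_valD vr_valM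
  vr_val1 coef_map /=.
rewrite (vr_to_O (pert_coef_ge0 (ltn_ord l))) (vr_to_O break_elt_pi_ge0) /pert_coef.
rewrite mulrAC divfK ?red_scale_neq0 // -mulrA -exprMn mulrDr mulr1; congr (_ * _ ^+ _).
by field; exact: piL_neq0.
Qed.

Definition pert_resid := \sum_(l < e) resid (pert_coef l).

(** The reduction is constant for two reasons. In the wild case [break_elt / piL] has residue 0. In
    the tame case it is 1, but then u = 1, and for l > 0 an integer m with m + l/e >= 1 satisfies m
    >= 1, so the term of index l has value above u and only l = 0 survives. *)
Lemma pert_scaled_red : map_poly redL pert_scaled = pert_resid%:P.
Proof.
rewrite rmorph_sum /= /pert_resid rmorph_sum /=; apply: eq_bigr => l _.
rewrite rmorphM rmorphXn rmorphD rmorphM rmorph1 /= !map_polyC map_polyX /=.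
rewrite -![redL (to_O _)]/(resid _).
case: (posnP break_exp) => [exp0|exp_gt0]; last first.
  have -> : resid (break_elt / piL) = 0.
    by apply/(resid_eq0 break_elt_pi_ge0);
      rewrite w_break_elt_pi lte_fin divr_gt0 ?ltr0n ?dimL_gt0.
  by rewrite mul0r addr0 expr1n mulr1.
have [->|l0] := eqVneq (l : nat) 0%N; first by rewrite expr0 mulr1.
suff -> : resid (pert_coef l) = 0 by rewrite !mul0r.
apply/(resid_eq0 (pert_coef_ge0 (ltn_ord l))); apply: (val_div_gt w_red_scale).
rewrite addr0 max_upper_tame // valuationM w_ext w_piX.
have := fg.2 l (ltn_ord l); rewrite max_upper_tame //.
have [->|hl0] := eqVneq (g - f)`_l 0; first by rewrite valuation0 addye // ltey.
have [m ->] := vK_int vK_discrete hl0; rewrite -EFinD lee_fin lte_fin.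
have l_gt : 0 < (l : nat)%:R / e%:R :> R by apply: divr_gt0; rewrite ltr0n ?dimL_gt0 ?lt0n.
have l_lt : (l : nat)%:R / e%:R < 1 :> R by rewrite ltr_pdivrMr ?dimR_gt0 // mul1r ltr_nat.
move: l_gt l_lt; set t := _ / _ => l_gt l_lt m_ge.
have m_gt : (0 : int)%:~R < m%:~R :> R by rewrite mulr0z; lra.
have : (1 : int)%:~R <= m%:~R :> R by rewrite ler_int; rewrite ltr_int in m_gt; lia.
by rewrite mulr1z; lra.
Qed.

Definition g_scaled := f_scaled + pert_scaled.

Lemma g_scaled_eval (x : O) : vr_val g_scaled.[x] * red_scale = (inL g).[piL + break_elt
  * vr_val x].
Proof.
rewrite /g_scaled hornerD vr_valD mulrDl f_scaled_eval pert_scaled_eval -hornerD -rmorphD.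
by rewrite addrC subrK.
Qed.

Lemma g_scaled_red : map_poly redL g_scaled = aff_poly H theta + pert_resid%:P.
Proof. by rewrite rmorphD /= f_scaled_red pert_scaled_red. Qed.

Lemma g_scaled_red_root (x : O) : (0 < w (vr_val g_scaled.[x]))%E <->
  root (aff_poly H theta + pert_resid%:P) (redL x).
Proof.
rewrite -g_scaled_red /root horner_map /=.
by split=> [/redL_eq0 G0|/eqP /redL_eq0 //]; apply/eqP.
Qed.

(** Nondegeneracy makes the reduction separable, so the residual root is simple and lifts. *)
Lemma root_of_residue_root a : aff_nondeg H theta psi pert_resid ->
  root (aff_poly H theta + pert_resid%:P) a -> exists b : L, root (inL g) b.
Proof.
move=> nd ra; have [a0 _ aP] := redL_surj a.
have wa0 : (0 <= w (val a0)%:A)%E by rewrite w_ext; exact: (valP a0).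
have redx0 := aP (to_O (val a0)%:A) (to_OK wa0).
have [||x Gx] := @hensel g_scaled (to_O (val a0)%:A).
- by apply/g_scaled_red_root; rewrite redx0.
- apply: redL_neq0; rewrite -horner_map -deriv_map /= g_scaled_red redx0.
  have := aff_poly_separable theta_psi_affine nd; rewrite unlock.
  by move=> /coprimep_root; apply.
by exists (piL + break_elt * vr_val x); rewrite /root -g_scaled_eval Gx mul0r.
Qed.

Lemma residue_root_of_root b : root (inL g) b -> (max_lower%:E <= w (b - piL)%R)%E ->
  exists a, root (aff_poly H theta + pert_resid%:P) a.
Proof.
move=> gb bi; have x0 : (0 <= w ((b - piL) / break_elt)%R)%E.
  by apply: (val_div_ge w_break_elt); rewrite addr0.
exists (redL (to_O ((b - piL) / break_elt))); apply/g_scaled_red_root.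
suff -> : vr_val g_scaled.[to_O ((b - piL) / break_elt)] = 0 by rewrite valuation0 ltey.
apply: (mulIf red_scale_neq0);
  rewrite mul0r g_scaled_eval vr_to_O // mulrC divfK ?break_elt_neq0 //.
by rewrite addrC subrK; exact/rootP.
Qed.

(** In the tame case [break_elt] is [piL], so X = -1 is the point piL + break_elt X = 0. As u = 1
    there, -1 is a residual root exactly when v(g_0) > 1, which the Eisenstein condition forbids. *)
Lemma g_scaled_N1 : break_exp = 0%N -> vr_val g_scaled.[-1] * red_scale = (g`_0)%:A.
Proof.
move=> exp0; rewrite g_scaled_eval /break_elt exp0 expr1 -[vr_val (-1)]/(-1 : L) mulrN1
  subrr.
by rewrite horner_coef0 coef_map.
Qed.

Lemma N1_root : break_exp = 0%N ->
  root (aff_poly H theta + pert_resid%:P) (-1) <-> (1%:E < vK g`_0)%E.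
Proof.
move=> exp0; rewrite -(rmorphN1 redL) -g_scaled_red_root -w_ext -g_scaled_N1 //.
rewrite valuationM w_red_scale max_upper_tame //.
have [->|G0] := eqVneq (vr_val g_scaled.[-1]) 0.
  by rewrite valuation0 addye // !ltey.
by rewrite (val_fin w G0) -EFinD !lte_fin ltrDr.
Qed.

Lemma eisenstein_nondeg : eisenstein vK e g -> aff_nondeg H theta psi pert_resid.
Proof.
move=> [_ _ _ g0]; case: (posnP break_exp) => [exp0|exp_gt0].
  by right; apply/negP => /(N1_root exp0); rewrite g0 ltxx.
by left=> s; exact: psi_wild.
Qed.

End Perturbation.

Lemma close_eisenstein_val g : eisenstein vK e g ->
  close_to_f g <-> (max_upper%:E <= eisenstein_val vK e f g)%E.
Proof.
move=> eg; split=> [[_ ge]|ge].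
  rewrite /eisenstein_val; elim/big_ind: _ => [|x y ux uy|l _].
  - exact: leey.
  - by rewrite le_min ux.
  by have := ge l (ltn_ord l); rewrite coefB -valuationN opprB.
split=> [|l le]; first exact: eisenstein_size_sub eg f_eis.
apply: le_trans ge _; rewrite /eisenstein_val (bigD1 (Ordinal le)) //=.
by rewrite coefB -valuationN opprB ge_min lexx.
Qed.

(* If the conjugate s piL closest to b had w (b - s piL) < max_lower, then
   w (f b) would be < max_upper. *)
Lemma shift_root g b : eisenstein vK e g -> close_to_f g -> root (inL g) b ->
  exists2 b', root (inL g) b' & (max_lower%:E <= w (b' - piL)%R)%E.
Proof.
move=> eg fg gb.
have wb : w b = (e%:R^-1)%:E by apply: eisenstein_root_val eg gb => //; exact: dimL_gt0.
have [s0 _ s0max] : exists2 s0 : gal_of {:L}, s0 \in G &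
    forall s : gal_of {:L}, (w (b - s piL)%R <= w (b - s0 piL)%R)%E.
  have [s0 _ s0P] := @arg_maxP _ _ _ (1%g : gal_of {:L}) xpredT
    (fun s : gal_of {:L} => w (b - s piL)) isT.
  by exists s0 => [|s]; [exact: mem_gal1 | exact: (s0P s isT)].
have shift x : (s0^-1)%g (s0 x) = x by rewrite -gal_mulE mulgV gal_id.
exists ((s0^-1)%g b).
  by rewrite /root -gal_inL (rootP gb) rmorph0.
have -> : (s0^-1)%g b - piL = (s0^-1)%g (b - s0 piL) by rewrite rmorphB /= shift.
rewrite w_gal leNgt; apply/negP => lt_i0.
have nz (s : gal_of {:L}) : b - s piL != 0.
  apply: contraTneq lt_i0 => bs; rewrite -leNgt; apply: le_trans (s0max s).
  by rewrite bs valuation0 leey.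
have wf : (max_upper%:E <= w (inL f).[b])%E.
  have -> : (inL f).[b] = - (inL (g - f)).[b].
    by rewrite rmorphB hornerD hornerN (rootP gb) sub0r opprK.
  rewrite valuationN (horner_coef_wide _ (n := e)) ?size_map_poly ?fg.1 //.
  apply: val_sum_ge => l _; rewrite coef_map valuationM w_ext (valX_fin _ wb).
  by have := fg.2 l (ltn_ord l); rewrite mulr_natl.
move: wf; rewrite f_conj_prod horner_prod.
rewrite (@val_prod_fin _ _ w _ _ _ _ (fun s : gal_of {:L} => fine (w (b - s piL)))) =>
  [|s _]; last first.
  by rewrite hornerXsubC; apply: val_fin; exact: nz.
rewrite lee_fin leNgt => /negP; apply.
rewrite (eq_bigl xpredT) => [|s]; last exact: mem_gal1.
rewrite (reindex_inj (mulIg s0)) /= (bigD1 1%g) //= mul1g.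
apply: ltr_leD.
  by rewrite -lte_fin -val_fin // nz.
(* By the choice of [s0], b - s0 piL is at least as close to 0 as x = b - s0 (s piL), so their
   difference s0 (s piL - piL), of value i(s), has value at least w(x). *)
apply: ler_sum => s s1; rewrite -lee_fin -val_fin ?nz //.
rewrite -lower_indexRE // -(w_gal s0 (s piL - piL)); set x := b - _.
have -> : s0 (s piL - piL) = (b - s0 piL) - x.
  by rewrite /x gal_mulE rmorphB /=; ring.
apply: le_trans (valB _ _ _); rewrite le_min lexx andbT; exact: s0max.
Qed.

(** Division of e u by e with remainder. The remainder l selects the monomial a X^l to be added to
    [f], and q is the value of a for which a piL^l has value u; q > 0 comes from u >= 1. *)
Lemma max_upper_frac : exists q l : nat, [/\ (0 < q)%N, (l < e)%N & max_upper = q%:R +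
  l%:R / e%:R].
Proof.
have [m] := w_int red_scale_neq0; rewrite w_red_scale => -[um].
have m_ge : (e%:Z + break_exp%:Z)%:~R <= m%:~R :> R.
  rewrite -(@ler_pM2r _ (e%:R^-1)) ?invr_gt0 ?dimR_gt0 // -um intrD mulrDl.
  by rewrite -[e%:Z%:~R]/(e%:R : R) mulfV ?gt_eqF ?dimR_gt0 //; exact: max_upper_ge.
rewrite ler_int in m_ge; case: m um m_ge => // m um m_ge.
exists (m %/ e)%N, (m %% e)%N; rewrite ltn_mod dimL_gt0 divn_gt0 ?dimL_gt0; split=> //.
  by move: m_ge; lia.
rewrite um {1}(divn_eq m e) -[(Posz _)%:~R]/(_%:R) natrD natrM mulrDl mulfK //.
by rewrite gt_eqF ?dimR_gt0.
Qed.

Lemma resid_alg (b : val_ring_of vK) : resid (val b)%:A = red b.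
Proof.
apply: redL_uniq; rewrite to_OK ?subrr ?valuation0 ?ltey //.
by rewrite w_ext; exact: (valP b).
Qed.

Lemma perturbation_exists c : aff_nondeg H theta psi c ->
  exists2 g, close_to_f g & eisenstein vK e g /\ pert_resid g = c.
Proof.
move=> nd; have [q [l [q_gt0 le u0E]]] := max_upper_frac.
have [a1 va1] := vK_surj vK_discrete q.
have wx : w (a1%:A * piL ^+ l / red_scale) = 0%E.
  by rewrite (@val_div_fin _ _ w _ _ max_upper max_upper _ w_red_scale) ?subrr //
    valuationM w_ext va1 w_piX u0E.
(* [b] rescales the unit a1 piL^l / red_scale so that its residue becomes [c]. *)
have [b redb] := red_residue.1 (c / resid (a1%:A * piL ^+ l / red_scale)).
have b_ge0 : (0 <= vK (val b))%E := valP b.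
pose a := val b * a1; pose g := f + a *: 'X^l.
have va : (q%:R%:E <= vK a)%E by rewrite valuationM va1 leeDr.
have gf : g - f = a *: 'X^l by rewrite /g addrC addKr.
have gfE i : (g - f)`_i = if i == l then a else 0.
  by rewrite gf coefZ coefXn; case: eqP; rewrite ?mulr1 ?mulr0.
have s_gf : (size (g - f)%R <= e)%N.
  by rewrite gf (leq_trans (size_scale_leq _ _)) // size_polyXn.
have fg : close_to_f g.
  split=> // i ie; rewrite gfE; case: eqP => [->|_]; last first.
    by rewrite valuation0 addye // leey.
  by rewrite u0E EFinD leeD2r.
have pert_residE : pert_resid g = c.
  rewrite /pert_resid (bigD1 (Ordinal le)) //= big1 ?addr0 => [|i il].
    rewrite /pert_coef gfE eqxx.
    have -> : a%:A * piL ^+ l / red_scale = (val b)%:A * (a1%:A * piL ^+ l / red_scale).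
      by rewrite /a -scalerA -(mulr_algl (val b)) !mulrA.
    rewrite residM ?wx ?w_ext // resid_alg redb divfK //.
    exact: resid_neq0.
  rewrite /pert_coef gfE (negPf (_ : _ != l)) ?scale0r ?mul0r; last first.
    by apply: contra il => /eqP il; apply/eqP/val_inj.
  by apply/(resid_eq0 _); rewrite valuation0 // leey.
have [mf sf fi f0] := f_eis.
have gE : g = f + (g - f) by rewrite addrC subrK.
have s_lt : (size (g - f)%R < size f)%N by rewrite sf ltnS.
have gi i : (i < e)%N -> (1%:E <= vK g`_i)%E.
  move=> ie; rewrite gE coefD; apply: le_trans (valuationD _ _ _); rewrite le_min fi //.
  rewrite gfE; case: eqP => [_|]; last by rewrite valuation0 leey.
  by apply: le_trans va; rewrite lee_fin ler1n.
exists g => //; split=> //; split=> //.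
- by rewrite gE monicE lead_coefDl // -monicE.
- by rewrite gE size_polyDl.
(* Only the constant term is at risk. In the tame case a value above 1 would make -1 a residual
   root; in the wild case l = 0 gives q = u > 1, so adding a does not change the value of the
   constant term. *)
apply/le_anti; rewrite gi ?dimL_gt0 // andbT; case: (posnP break_exp) => [exp0|exp_gt0].
  rewrite leNgt; apply/negP => /(N1_root fg exp0); rewrite pert_residE; apply/negP.
  case: nd => // psi1; have [s sH] := H_psi_neq1 exp0.
  by rewrite psi1 // eqxx.
rewrite gE coefD gfE; case: eqP => [l0|_]; last by rewrite addr0 f0.
rewrite valD_lt f0 //; apply: lt_le_trans va.
have := max_upper_ge; rewrite u0E -l0 mul0r addr0; apply: lt_le_trans.
by rewrite ltrDl divr_gt0 ?ltr0n ?dimL_gt0.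
Qed.

Theorem roots_in_L_criterion :
  (forall g, eisenstein vK e g -> (max_upper%:E <= eisenstein_val vK e f g)%E ->
     exists b : L, root (inL g) b) <->
  (forall c, aff_nondeg H theta psi c -> exists a, root (aff_poly H theta + c%:P) a).
Proof.
split=> [roots c nd|roots g eg /(close_eisenstein_val eg) fg].
  have [g fg [eg gc]] := perturbation_exists nd.
  have [b gb] := roots g eg ((close_eisenstein_val eg).1 fg).
  have [b' gb' bi] := shift_root eg fg gb.
  by rewrite -gc; exact: residue_root_of_root gb' bi.
have nd := eisenstein_nondeg fg eg.
by have [a ra] := roots _ nd; exact: root_of_residue_root nd ra.
Qed.

End Ramification.
End Completeness.
End ResidueField.
End TotallyRamified.

(** * Property (T) in terms of roots in L *)

Section PropertyT.
Variables (R : realType) (K : fieldType) (vK : valuation R K).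
Hypothesis vK_discrete : normalized_discrete vK.
Variables (Omega : closedFieldType) (iota : {rmorphism K -> Omega}).
Variables (L : splittingFieldType K) (j : {rmorphism L -> Omega}).
Hypothesis j_K : forall a : K, j a%:A = iota a.
Variable w : valuation R L.
Hypothesis w_ext : forall a : K, w a%:A = vK a.
Hypothesis L_galois : galois 1%AS {:L}%AS.
Notation e := (\dim {:L}).
Notation inL := (map_poly (in_alg L)).

(** By orthogonality a nonzero polynomial of degree less than e has a finite value at [b], hence
    does not vanish there. So the minimal polynomial has degree e. *)
Lemma eisenstein_minPoly g b : eisenstein vK e g -> root (inL g) b ->
  inL g = minPoly 1%AS b.
Proof.
move=> eg gb; have [mg sg _ _] := eg.
have wb : w b = (e%:R^-1)%:E by apply: eisenstein_root_val eg gb => //; exact: dimL_gt0.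
have /polyOver1P [m Dm] := minPolyOver 1%AS b.
have m_g : minPoly 1%AS b %| inL g.
  by apply: minPoly_dvdp => //; apply/polyOver1P; exists g.
have m0 : m != 0.
  have := monic_neq0 (monic_minPoly 1%AS b); rewrite Dm.
  by apply: contraNneq => ->; rewrite rmorph0.
have size_m : (e < size m)%N.
  rewrite ltnNge; apply/negP => sm.
  have : w (inL m).[b] = \big[Order.min/+oo%E]_(l < e) (vK m`_l + (l%:R / e%:R)%:E)%E.
    by apply: val_horner => //; exact: dimL_gt0.
  rewrite -Dm (rootP (root_minPoly _ _)) valuation0 => /esym m_y.
  move/eqP: m0; apply; apply/polyP => l; rewrite coef0.
  have [el|le] := leqP e l; first by rewrite nth_default // (leq_trans sm).
  apply: contrapT => /eqP ml; have : (+oo <= vK m`_l + (l%:R / e%:R)%:E)%E.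
    by rewrite -m_y (bigD1 (Ordinal le)) //= ge_min lexx.
  by rewrite (val_fin vK ml) -EFinD leye_eq.
apply/eqP; rewrite -eqp_monic ?monic_minPoly ?map_monic // eqp_sym -dvdp_size_eqp //.
rewrite eqn_leq dvdp_leq ?monic_neq0 ?map_monic //=.
by rewrite size_map_poly sg Dm size_map_poly.
Qed.

Lemma subfx_inj_alg g (pi_g : Omega) (z : subFExtend iota pi_g g) (q : {poly K}) :
  root (map_poly iota g) pi_g -> g != 0 ->
  subfx_inj (map_poly (in_alg (subFExtend iota pi_g g)) q).[z]
  = (map_poly iota q).[subfx_inj z].
Proof.
move=> gpi g0; rewrite -horner_map -map_poly_comp; congr horner.
by apply: eq_map_poly => a /=; rewrite subfx_inj_base.
Qed.

(** L is normal, so one root of [g] in L gives them all, and [pi_g] is j b'. Then j(L) and the image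
    of the abstract field in [Omega] both consist of the polynomial values at [pi_g], and the
    isomorphism is read off inside [Omega]. *)
Lemma iso_of_root g b (pi_g : Omega) : eisenstein vK e g -> root (inL g) b ->
  root (map_poly iota g) pi_g ->
  exists phi : {lrmorphism L -> subFExtend iota pi_g g}, bijective phi.
Proof.
move=> eg gb gpi; have [mg sg _ _] := eg.
have g0 : g != 0 by rewrite monic_neq0.
have j_inL (q : {poly K}) x : j (inL q).[x] = (map_poly iota q).[j x].
  rewrite -horner_map -map_poly_comp; congr horner.
  by apply: eq_map_poly => a /=; rewrite j_K.
have [b' gb' jb'] : exists2 b', root (inL g) b' & j b' = pi_g.
  have gprod := f_conj_prod eg (eisenstein_minPoly eg gb) L_galois.
  have : root (map_poly j (inL g)) pi_g.
    by rewrite -map_poly_comp (@eq_map_poly _ _ _ iota).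
  rewrite gprod rmorph_prod /= => /rootP; rewrite horner_prod => /eqP.
  move/prodf_eq0 => [s sG]; rewrite map_polyXsubC hornerXsubC subr_eq0 => /eqP pis.
  exists (s b) => //; rewrite /root horner_prod; apply/prodf_eq0.
  by exists s => //; rewrite hornerXsubC subrr.
pose S := subFExtend iota pi_g g.
pose inj : S -> Omega := subfx_inj.
have inj_inj : injective inj by exact: fmorph_inj.
have phiP x : exists z : S, inj z = j x.
  have [h _ ->] := pi_span eg (eisenstein_minPoly eg gb') x.
  by exists (subfx_eval iota pi_g g h); rewrite /inj subfx_inj_eval // j_inL jb'.
have psiP (z : S) : exists x, j x = inj z.
  have [q ->] := subfxE z; exists (inL q).[b'].
  by rewrite /inj subfx_inj_eval // j_inL jb'.
have [phi phiE] := choice phiP; have [psi psiE] := choice psiP.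
have phi_zmod : zmod_morphism phi.
  by move=> x y; apply: inj_inj; rewrite phiE /inj !rmorphB /= -!/(inj _) !phiE.
have phi_monoid : monoid_morphism phi.
  split=> [|x y]; apply: inj_inj; rewrite phiE /inj.
    by rewrite !rmorph1.
  by rewrite !rmorphM /= -!/(inj _) !phiE.
have phi_scal : scalable phi.
  move=> a x; apply: inj_inj; rewrite phiE /inj subfx_injZ // -/(inj _) phiE.
  by rewrite -mulr_algl rmorphM /= j_K.
pose zM := GRing.isZmodMorphism.Build L S phi phi_zmod.
pose mM := GRing.isMonoidMorphism.Build L S phi phi_monoid.
pose sM := GRing.isScalable.Build K L S *:%R phi phi_scal.
pose Phi : {lrmorphism L -> S} := HB.pack phi zM mM sM.
exists Phi; exists psi => [x|z].
  by apply: (fmorph_inj j); rewrite psiE phiE.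
by apply: inj_inj; rewrite phiE psiE.
Qed.

Lemma root_of_iso g (pi_g : Omega) (phi : {lrmorphism L -> subFExtend iota pi_g g}) :
  root (map_poly iota g) pi_g -> g != 0 -> bijective phi ->
  exists b, root (inL g) b.
Proof.
move=> gpi g0 [psi _ psiK].
exists (psi (subfx_root iota pi_g g)); rewrite /root.
rewrite -(fmorph_eq0 phi) -(fmorph_eq0 (@subfx_inj _ _ iota pi_g g)).
rewrite -horner_map -map_poly_comp /= psiK.
rewrite (@eq_map_poly _ _ _ (in_alg (subFExtend iota pi_g g))).
  by rewrite subfx_inj_alg // subfx_inj_root // (rootP gpi).
by move=> a /=; rewrite linearZ /= rmorph1.
Qed.

Lemma property_TP (f : {poly K}) (m : R) :
  property_T vK iota L e f m <->
  (forall g, eisenstein vK e g -> (m%:E <= eisenstein_val vK e f g)%E ->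
     exists b : L, root (inL g) b).
Proof.
split=> [T g eg fg|roots g eg fg pi_g gpi]; last first.
  by have [b gb] := roots g eg fg; exact: iso_of_root gb gpi.
have [mg sg _ _] := eg; have g0 : g != 0 by rewrite monic_neq0.
have /closed_rootP [pi_g gpi] : size (map_poly iota g) != 1%N.
  by rewrite size_map_poly sg eqSS -lt0n dimL_gt0.
by have [phi phi_bij] := T g eg fg pi_g gpi; exact: root_of_iso phi_bij.
Qed.

End PropertyT.

Theorem theorem5p1 (R : realType)
  (* K is a complete discrete valuation field, vK(K^* ) = Z *)
  (K : fieldType) (vK : valuation R K)
  (vK_discrete : normalized_discrete vK) (vK_complete : val_complete vK)
  (* k is its residue field, of characteristic p *)
  (k : fieldType) (red : {rmorphism val_ring_of vK -> k})
  (red_residue : residue_map red) (p : nat) (k_char : p \in [pchar k])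
  (* ks is a separable closure of k *)
  (ks : fieldType) (iotak : {rmorphism k -> ks})
  (ks_closure : separable_closure iotak)
  (* Omega is an algebraic closure of K, with the extension of vK *)
  (Omega : closedFieldType) (iota : {rmorphism K -> Omega})
  (Omega_alg : forall x : Omega, algebraicOver iota x)
  (v : valuation R Omega) (v_ext : forall x : K, v (iota x) = vK x)
  (* L is a finite totally ramified Galois extension of K in Omega *)
  (L : splittingFieldType K) (j : {rmorphism L -> Omega})
  (j_K : forall a : K, j (a%:A) = iota a)
  (L_galois : galois 1%AS {:L}%AS) (L_neqK : {:L}%VS != 1%VS)
  (L_totram : value_group_frac (val_comp v j) (\dim {:L}))
  (* f is the minimal polynomial of a uniformizer of L *)
  (piL : L) (piL_unif : uniformizer (val_comp v j) piL)
  (f : {poly K}) (f_eis : eisenstein vK (\dim {:L}) f)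
  (f_min : map_poly (in_alg L) f = minPoly 1%AS piL) :
  property_T vK iota L (\dim {:L}) f (upper_break (val_comp v j))
  <-> Hom_cont_trivial iotak
        (lower_group (val_comp v j) (lower_break (val_comp v j))).
Proof.
have w_ext (a : K) : val_comp v j a%:A = vK a by rewrite /= j_K v_ext.
have crit := roots_in_L_criterion vK_discrete w_ext L_totram piL_unif f_eis
  f_min red_residue vK_complete L_galois L_neqK.
have affA := theta_psi_affine vK_discrete w_ext L_totram piL_unif f_eis f_min
  red_residue L_galois L_neqK.
have homP := Hom_cont_trivialP affA ks_closure.
rewrite (upper_breakE vK_discrete w_ext L_totram piL_unif f_eis f_min L_galois L_neqK).
rewrite (lower_breakE vK_discrete w_ext L_totram piL_unif f_eis f_min L_galois L_neqK).
have TP := property_TP vK_discrete j_K w_ext L_galois.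
by split=> [/TP/crit/homP|/homP/crit/TP].
Qed.
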